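(* Let $\mu$ be a probability measure on $\mathbb{R}^d$ that is absolutely continuous with respect to Lebesgue measure, let $t>0$, and let $\eta$ be a Poisson point process on $\mathbb{R}^d$ with intensity measure $t\mu$. Let $\Pi_t=[\eta]$ be the convex hull of the points of $\eta$, let $N(\Pi_t)$ be the number of vertices of $\Pi_t$, and let $\Delta(\Pi_t)=\mu(\mathbb{R}^d\setminus\Pi_t)$. Then for every $k\in\mathbb{N}$, $$\mathbb{E}\, N(\Pi_t)_{(k)}=t^k\,\mathbb{E}\,\Delta(\Pi_t)^k - t^k\sum_{r=1}^{k-1}(-1)^{r+1}\binom{k}{r}\,\mathbb{E}\int_{\mathbb{R}^d\setminus\Pi_t}\!\!\cdots\int_{\mathbb{R}^d\setminus\Pi_t}\mu\big([\eta,x_1,\dots,x_{k-r}]\setminus[\eta]\big)^r\,\mu(\mathrm{d}x_1)\cdots\mu(\mathrm{d}x_{k-r}),$$ where $n_{(k)}=n(n-1)\cdots(n-k+1)$.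
   Context: For a point set $\xi$, $[\xi]$ denotes its convex hull, and $[\eta,x_1,\dots,x_m]$ denotes the convex hull of the points of $\eta$ together with the points $x_1,\dots,x_m$. A Poisson point process $\eta$ with intensity measure $t\mu$ is a random finite simple counting measure such that $\eta(A)$ is Poisson distributed with parameter $t\mu(A)$ for every Borel set $A$ and counts of pairwise disjoint Borel sets are independent. *)

(* Defs.v *)
From HB Require Import structures.
From mathcomp Require Import all_boot all_order all_algebra.
From mathcomp Require Import finmap.
From mathcomp Require Import all_classical all_reals all_analysis.
Set Implicit Arguments. Unset Strict Implicit. Unset Printing Implicit Defensive.
Import Order.TTheory GRing.Theory Num.Theory.
Local Open Scope classical_set_scope.
Local Open Scope ring_scope.

(* Points of R^d are d-tuples of reals; [d.-tuple R] carries the product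
   (Borel) sigma-algebra generated by the coordinate projections
   (mathcomp-analysis instance in measurable_structure.v). *)
Section Defs.
Context {R : realType} {d : nat}.
Local Notation V := (d.-tuple R).

Definition box (a b : V) : set V :=
  [set x | forall j : 'I_d, tnth a j <= tnth x j <= tnth b j].
Definition box_vol (a b : V) : R := \prod_(j < d) (tnth b j - tnth a j).

Definition lebesgue_null (A : set V) : Prop :=
  forall eps : R, 0 < eps ->
    exists a b : nat -> V,
      (forall n, forall j : 'I_d, tnth (a n) j <= tnth (b n) j) /\
      A `<=` \bigcup_n box (a n) (b n) /\
      (\sum_(n <oo) (box_vol (a n) (b n))%:E < eps%:E)%E.

Definition abs_cont_lebesgue (mu : set V -> \bar R) : Prop :=
  forall A : set V, measurable A -> lebesgue_null A -> mu A = 0%E.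

Definition hull (S : {fset V}) : set V :=
  [set x | exists lam : V -> R,
     (forall y, y \in S -> 0 <= lam y) /\
     \sum_(y <- S) lam y = 1 /\
     forall j : 'I_d, tnth x j = \sum_(y <- S) lam y * tnth y j].

Definition extreme_point (C : set V) (x : V) : Prop :=
  C x /\ forall (y z : V) (l : R), C y -> C z -> 0 < l < 1 ->
    (forall j : 'I_d, tnth x j = l * tnth y j + (1 - l) * tnth z j) -> y = z.

(* number of vertices of the polytope [S]; every vertex (extreme point)
   of [S] lies in S, so we count the points of S that are extreme *)
Definition nvertices (S : {fset V}) : nat :=
  #|` [fset x in S | `[< extreme_point (hull S) x >]]|%fset.

Definition pcount (S : {fset V}) (A : set V) : nat :=
  #|` [fset x in S | `[< A x >]]|%fset.

Definition poisson_p (lam : R) (n : nat) : R :=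
  expR (- lam) * lam ^+ n / n`!%:R.

Definition is_PPP {dO : measure_display} {Omega : measurableType dO}
  (P : probability Omega R) (t : R) (mu : set V -> \bar R)
  (eta : Omega -> {fset V}) : Prop :=
  (forall A : set V, measurable A -> forall n : nat,
      measurable [set w | pcount (eta w) A = n]) /\
  (forall A : set V, measurable A -> forall n : nat,
      P [set w | pcount (eta w) A = n] = (poisson_p (t * fine (mu A)) n)%:E) /\
  (forall (m : nat) (A : 'I_m -> set V), (forall i, measurable (A i)) ->
     (forall i j, i != j -> A i `&` A j = set0) ->
     forall ns : 'I_m -> nat,
       P (\bigcap_(i in [set: 'I_m]) [set w | pcount (eta w) (A i) = ns i])
       = (\prod_(i < m) P [set w | pcount (eta w) (A i) = ns i])%E).

Fixpoint iter_int (mu : {measure set V -> \bar R}) (D : set V) (n : nat)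
  (f : seq V -> \bar R) {struct n} : \bar R :=
  match n with
  | 0 => f [::]
  | n'.+1 => (\int[mu]_(x in D) iter_int mu D n' (fun s => f (x :: s)))%E
  end.

End Defs.

(* Main.v *)
(* A Poisson process is determined by its void probabilities, so the law of
   [eta] is that of a Poisson number of independent mu-distributed points.
   Exchangeability of these points gives the Mecke formula
     E N_(k) = t^k E int 1[y_1, ..., y_k are all vertices of [eta, y_1, ..., y_k]].
   For a fixed configuration S let Z(n,i,j) integrate
     1[all y are vertices of T] mu([T] \ [S])^i,  T = S + b + y,
   over n points y and over j points b outside [S]. An additional point b outside
   [S] either is a vertex of the new hull, or lies in the old hull and then does
   not change it, so Z(n,i,j+1) = Z(n+1,i,j) + Z(n,i+1,j). Unrolling this Pascal
   recursion from Z(k,0,0) down to n = 0 yields the alternating sum. *)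
Require Import Defs.
From HB Require Import structures.
From mathcomp Require Import all_boot all_order all_algebra.
From mathcomp Require Import finmap lra ring.
From mathcomp Require Import all_classical all_reals all_analysis.
From mathcomp Require Import measurable_realfun.
Import Order.TTheory GRing.Theory Num.Theory.
Import numFieldNormedType.Exports.
Local Open Scope classical_set_scope.
Local Open Scope ring_scope.

Set Implicit Arguments. Unset Strict Implicit. Unset Printing Implicit Defensive.

(** * Polytopes and rational half-spaces *)

(** The functionals of [eta w] have to be measurable for a sigma-algebra on which the law of [eta]
    is known. The choice is the one generated by the void events: these are stable under
    intersection, and hull membership and vertex status are expressible by countably many of them,
    because rational half-spaces separate points from polytopes. Farkas' lemma supplies such
    half-spaces. The Pascal recursion is solved by subtraction, hence among real numbers; this is
    legitimate because every Z(n,i,j) integrates a function with values in [0, 1] against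
    probability measures. Once n = 0 is reached, the index r counts the steps that raised the power
    of the gap. The term r = 0 is the moment of the missed mass; for r = k no point b is left, the
    gap is empty and the term vanishes, which leaves 1 <= r < k for the sum. *)

Section Farkas.
Context {F : realFieldType} {J : finType} {T : eqType}.
Implicit Types (v : T -> J -> F) (a b : J -> F) (s : seq T).

Definition dotp a b : F := \sum_j a j * b j.

Lemma dotpDl a1 a2 (c : F) b :
  dotp (fun j => a1 j - c * a2 j) b = dotp a1 b - c * dotp a2 b.
Proof.
rewrite /dotp mulr_sumr -sumrB; apply: eq_bigr => j _; ring.
Qed.

Lemma dotpDr a b1 b2 (c : F) :
  dotp a (fun j => b1 j - c * b2 j) = dotp a b1 - c * dotp a b2.
Proof.
rewrite /dotp mulr_sumr -sumrB; apply: eq_bigr => j _; ring.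
Qed.

(** Induction on [s], with [v] and [b] general because the vectors get projected. A separator found
    without [y0] still works unless it is positive at [v y0]; it then provides the hyperplane onto
    which everything is projected along [v y0], and the induction hypothesis is used a second time
    there. *)
Lemma farkas s : uniq s -> forall v b,
  (exists lam : T -> F, (forall y, y \in s -> 0 <= lam y) /\
     forall j, b j = \sum_(y <- s) lam y * v y j) \/
  (exists a, (forall y, y \in s -> dotp a (v y) <= 0) /\ 0 < dotp a b).
Proof.
elim: s => [|y0 s IH] /=.
  move=> _ v b; have [b0|] := boolP [forall j, b j == 0].
    left; exists (fun=> 0); split=> // j.
    by rewrite big_nil; apply/eqP/(forallP b0).
  rewrite negb_forall => /existsP[j bj]; right; exists b; split=> //.
  rewrite /dotp (bigD1 j) //= ltr_pwDl //.
    by rewrite -expr2 exprn_even_gt0.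
  by apply: sumr_ge0 => i _; rewrite -expr2 sqr_ge0.
move=> /andP[y0s us] v b.
have sy0 y : y \in s -> (y == y0) = false.
  by move=> ys; apply/negP => /eqP yy; rewrite -yy ys in y0s.
have [[lam [lam0 blam]]|[a [a_s ab]]] := IH us v b.
  left; exists (fun y => if y == y0 then 0 else lam y); split=> [y|j].
    by rewrite inE; case: eqP => //= _ /lam0.
  rewrite big_cons eqxx mul0r add0r blam; apply: eq_big_seq => y ys.
  by rewrite sy0.
have [av0|av0] := lerP (dotp a (v y0)) 0.
  by right; exists a; split=> // y; rewrite inE => /orP[/eqP->|/a_s].
(* [pr] projects along [v y0] onto the orthogonal complement of [a]. *)
pose pr (u : J -> F) j := u j - (dotp a u / dotp a (v y0)) * v y0 j.
have av00 : dotp a (v y0) != 0 by rewrite gt_eqF.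
have apr u : dotp a (pr u) = 0 by rewrite dotpDr; field.
have [[lam [lam0 blam]]|[a' [a's a'b]]] := IH us (fun y => pr (v y)) (pr b).
  left.
  (* Undoing the projection: [c] collects the multiples of [v y0] removed from [b] and from the
     [v y]. It is nonnegative since [a] is positive at [b] and at [v y0] but nonpositive on [s]. *)
  pose c := dotp a b / dotp a (v y0)
            - \sum_(y <- s) lam y * (dotp a (v y) / dotp a (v y0)).
  exists (fun y => if y == y0 then c else lam y); split=> [y|j].
    rewrite inE; case: eqP => [_ _|_] /=; last exact: lam0.
    rewrite subr_ge0; apply: (@le_trans _ _ 0); last by rewrite divr_ge0 ?ltW.
    rewrite big_seq; apply: sumr_le0 => z zs.
    rewrite mulr_ge0_le0 ?lam0 // mulr_le0_ge0 ?a_s // invr_ge0 ltW //.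
  rewrite big_cons eqxx.
  have := blam j; rewrite /pr => /(canRL (subrK _)) ->.
  under [in RHS]eq_big_seq => y ys do rewrite sy0 //.
  suff -> : \sum_(y <- s) lam y * (v y j - dotp a (v y) / dotp a (v y0) * v y0 j) =
      \sum_(y <- s) lam y * v y j -
      (\sum_(y <- s) lam y * (dotp a (v y) / dotp a (v y0))) * v y0 j.
    by rewrite /c; ring.
  by rewrite mulr_suml -sumrB; apply: eq_bigr => y _; ring.
(* This [c] makes the new form vanish at [v y0]; it then equals [a'] composed with the
   projection. *)
right; pose c := dotp a' (v y0) / dotp a (v y0).
exists (fun j => a' j - c * a j).
have e0 : dotp a' (v y0) - c * dotp a (v y0) = 0 by rewrite /c; field.
have e u : dotp (fun j => a' j - c * a j) u = dotp a' (pr u).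
  rewrite dotpDl dotpDr /c; field => //.
split=> [y|]; last by rewrite e.
rewrite inE => /orP[/eqP->|/a's]; first by rewrite dotpDl e0.
by rewrite e.
Qed.

End Farkas.

Section Geometry.
Context {R : realType} {d : nat}.
Local Notation V := (d.-tuple R).
Implicit Types (S T : {fset V}) (x y : V) (q : (d.-tuple rat) * rat).

(* Half-spaces with rational coefficients form a countable family that still
   separates points from polytopes; all measurability proofs rest on this. *)
Definition rat_form q x : R :=
  \sum_(j < d) ratr (tnth q.1 j) * tnth x j + ratr q.2.
Definition Hs q : set V := [set x | 0 < rat_form q x].

Lemma mem_hull S x : x \in S -> hull S x.
Proof.
move=> xS; exists (fun y => (y == x)%:R); split=> [y _|]; first exact: ler0n.
split=> [|j].
  rewrite (big_fsetD1 x) //= eqxx big_seq big1 ?addr0 // => y.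
  by rewrite !inE => /andP[/negPf-> _].
rewrite (big_fsetD1 x) //= eqxx mul1r big_seq big1 ?addr0 // => y.
by rewrite !inE => /andP[/negPf-> _]; rewrite mul0r.
Qed.

Lemma hull_form_le S x q : hull S x -> (forall y, y \in S -> ~ Hs q y) ->
  ~ Hs q x.
Proof.
move=> [lam [lam0 [lam1 xE]]] SH; apply/negP; rewrite -leNgt.
suff -> : rat_form q x = \sum_(y <- S) lam y * rat_form q y.
  rewrite big_seq; apply: sumr_le0 => y yS; rewrite mulr_ge0_le0 ?lam0 //.
  by rewrite leNgt; apply/negP/SH.
rewrite /rat_form.
under [RHS]eq_bigr do rewrite mulrDr mulr_sumr.
rewrite big_split /= -mulr_suml lam1 mul1r exchange_big /=; congr (_ + _).
apply: eq_bigr => j _; rewrite xE mulr_sumr.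
by apply: eq_bigr => y _; ring.
Qed.

Lemma rat_approx (a : 'I_d -> R) (a0 e : R) : 0 < e -> exists q,
  (forall j, `|ratr (tnth q.1 j) - a j| <= e) /\ `|ratr q.2 - a0| <= e.
Proof.
move=> e0.
have app (c : R) : {r : rat | `|ratr r - c| <= e}.
  apply: cid.
  have /rat_in_itvoo[r] : c < c + e by rewrite ltrDl.
  rewrite in_itv/= => /andP[r1 r2]; exists r.
  by rewrite ger0_norm ?subr_ge0 ?ltW// ltrBlDl.
exists ([tuple projT1 (app (a j)) | j < d], projT1 (app a0)) => /=; split.
  by move=> j; rewrite tnth_mktuple; case: (app _).
by case: (app _).
Qed.

(** Farkas' lemma gives a real form that is nonpositive on [S] and equals [g > 0] at [x]. Lowering
    it by [g / 2] leaves a margin of [g / 2] on both sides, of which the rational approximation uses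
    up at most [g / 4]. *)
Lemma nhullP S x :
  ~ hull S x <-> exists q, Hs q x /\ forall y, y \in S -> ~ Hs q y.
Proof.
split; last by case=> q [qx qS] /hull_form_le/(_ qS).
move=> nx.
(* The extra coordinate [None], constantly 1, forces the coefficients of a conic combination to sum
   to 1. *)
pose vv (y : V) (o : option 'I_d) : R := if o is Some j then tnth y j else 1.
have [[lam [lam0 lamE]]|[a [aS ax]]] := farkas (fset_uniq S) vv (vv x).
  case: nx; exists lam; split=> //; split=> [|j]; last exact: (lamE (Some j)).
  by rewrite [RHS](lamE None); apply: eq_bigr => y _; rewrite mulr1.
pose g := dotp a (vv x).
pose f (y : V) := \sum_(j < d) a (Some j) * tnth y j + a None.
have fE y : dotp a (vv y) = f y.
  rewrite /dotp /f (bigD1 None) //= mulr1 addrC; congr (_ + _).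
  rewrite (reindex_omap (fun j => Some j) id) /=; last by case.
  by apply: eq_big => // j; rewrite eqxx.
pose M := \sum_(y <- (x |` S)%fset) (\sum_(j < d) `|tnth y j| + 1).
have M0 : 0 <= M.
  by apply: sumr_ge0 => y _; apply: addr_ge0 => //; apply: sumr_ge0.
have My y : y \in (x |` S)%fset -> \sum_(j < d) `|tnth y j| + 1 <= M.
  move=> yS; rewrite /M (big_fsetD1 y) //= lerDl; apply: sumr_ge0 => z _.
  by apply: addr_ge0 => //; apply: sumr_ge0.
(* At a point with coordinate sum at most [M] in absolute value (plus 1), coefficient errors [e]
   cost at most [e * M <= g / 4]. *)
pose e := g / (4 * (M + 1)).
have e0 : 0 < e by rewrite divr_gt0 // mulr_gt0 // ltr_wpDl.
have [q [q1 q2]] := rat_approx (fun j => a (Some j)) (a None - g / 2) e0.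
have bd y : y \in (x |` S)%fset -> `|rat_form q y - (f y - g / 2)| <= g / 4.
  move=> yS; apply: (@le_trans _ _ (e * M)); last first.
    rewrite /e mulrAC ler_pdivrMr ?mulr_gt0 ?ltr_wpDl//.
    rewrite [leRHS](_ : _ = g * (M + 1)); last by field.
    by rewrite ler_wpM2l ?ltW// ltrDl.
  apply: (le_trans _ (ler_wpM2l (ltW e0) (My _ yS))).
  rewrite [X in `|X|](_ : _ =
    \sum_(j < d) (ratr (tnth q.1 j) - a (Some j)) * tnth y j
    + (ratr q.2 - (a None - g / 2))); last first.
    under eq_bigr do rewrite mulrBl.
    by rewrite sumrB /rat_form /f; ring.
  rewrite mulrDr mulr1 (le_trans (ler_normD _ _))// lerD//.
  rewrite (le_trans (ler_norm_sum _ _ _))// mulr_sumr ler_sum// => j _.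
  by rewrite normrM ler_wpM2r.
have g0 : 0 < g by [].
exists q; split=> [|y yS]; rewrite /Hs /=.
  have := bd x (fset1U1 _ _); rewrite -fE -/g ler_norml => /andP[+ _].
  lra.
have := bd y (fset1Ur _ yS); rewrite ler_norml => /andP[_ +].
have := aS y yS; rewrite fE.
by move=> h1 h2; apply/negP; rewrite -leNgt; lra.
Qed.

(** Separation replaces the composition of convex combinations: a half-space missing [T] misses
    [hull T], hence [S], hence [hull S]. *)
Lemma hull_sub S T : (forall y, y \in S -> hull T y) -> hull S `<=` hull T.
Proof.
move=> ST x Sx; apply: contrapT => /nhullP[q [qx qT]].
apply: (hull_form_le Sx _ qx) => y /ST Ty.
exact: hull_form_le Ty qT.
Qed.

Lemma hullS S T : (S `<=` T)%fset -> hull S `<=` hull T.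
Proof. by move=> /fsubsetP ST; apply: hull_sub => y /ST /mem_hull. Qed.

Lemma hullU1 T x : hull T x -> hull (x |` T)%fset = hull T.
Proof.
move=> Tx; apply/seteqP; split; last by apply: hullS; apply: fsubsetUr.
by apply: hull_sub => y; rewrite !inE => /orP[/eqP->//|/mem_hull].
Qed.

(** [a] is the weight of [x] in a combination for [z]; it is below 1 because [z] is not [x], so the
    remaining weights can be renormalised to give [u]. *)
Lemma hullD1 T x z : x \in T -> hull T z -> z != x ->
  exists a (u : V), [/\ 0 <= a < 1, hull (T `\ x)%fset u &
    forall j, tnth z j = a * tnth x j + (1 - a) * tnth u j].
Proof.
move=> xT [lam [lam0 [lam1 zE]]] zx.
have lamx0 : 0 <= lam x by exact: lam0.
have sumE : \sum_(y <- (T `\ x)%fset) lam y = 1 - lam x.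
  by rewrite -lam1 (big_fsetD1 x xT) /= addrAC subrr add0r.
have s0 y : y \in (T `\ x)%fset -> 0 <= lam y.
  by rewrite !inE => /andP[_ /lam0].
have lamx1 : lam x < 1.
  rewrite -subr_gt0 -sumE lt_neqAle eq_sym; apply/andP; split; last first.
    by rewrite big_seq sumr_ge0.
  apply: contra zx; rewrite big_seq psumr_eq0 // => /allP h.
  apply/eqP/eq_from_tnth => j; rewrite zE (big_fsetD1 x) //=.
  rewrite (_ : lam x = 1) ?mul1r; last first.
    apply/eqP; rewrite eq_sym -subr_eq0 -sumE big_seq psumr_eq0 //; exact/allP.
  rewrite big_seq big1 ?addr0 // => y yT.
  by move: (h y yT); rewrite yT /= => /eqP->; rewrite mul0r.
have d0 : 1 - lam x != 0 by rewrite gt_eqF // subr_gt0.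
exists (lam x), [tuple (tnth z j - lam x * tnth x j) / (1 - lam x) | j < d].
split; first by rewrite lamx0.
  exists (fun y => lam y / (1 - lam x)); split=> [y yT|].
    by rewrite divr_ge0 ?s0 // subr_ge0 ltW.
  split=> [|j]; first by rewrite -mulr_suml sumE divff.
  rewrite tnth_mktuple zE (big_fsetD1 x) //= addrAC subrr add0r mulr_suml.
  by apply: eq_bigr => y _; ring.
by move=> j; rewrite tnth_mktuple; field.
Qed.

Lemma hull_convex T x y z (l : R) : hull T y -> hull T z -> 0 <= l <= 1 ->
  (forall j, tnth x j = l * tnth y j + (1 - l) * tnth z j) -> hull T x.
Proof.
move=> Ty Tz /andP[l0 l1] xE; apply: contrapT => /nhullP[q [qx qT]].
have := hull_form_le Ty qT; have := hull_form_le Tz qT.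
move=> /negP; rewrite -leNgt => hz /negP; rewrite -leNgt => hy.
suff : rat_form q x = l * rat_form q y + (1 - l) * rat_form q z.
  move: qx; rewrite /Hs /=; nra.
rewrite /rat_form !mulrDr !mulr_sumr addrACA -big_split /=; congr (_ + _).
  by apply: eq_bigr => j _; rewrite xE; ring.
by ring.
Qed.

(** If [x] is a combination of the other points, some [y] among them has positive weight, and [x]
    lies strictly between [y] and the renormalised rest. Conversely, if [x] lies strictly inside a
    segment of [hull T], removing the share of [x] from both end points puts [x] into the hull of
    the others. *)
Lemma extreme_hullD1 T x : x \in T ->
  extreme_point (hull T) x <-> ~ hull (T `\ x)%fset x.
Proof.
move=> xT; split=> [[_ ex] Tx|nx].
  have [] : exists2 y, y \in (T `\ x)%fset & 
     exists (z : V) (a : R), [/\ 0 <= a < 1, hull T z &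
      forall j, tnth x j = (1 - a) * tnth y j + a * tnth z j].
    case: Tx => lam [lam0 [lam1 xE]].
    have [/hasP[y yT ly]|] := boolP (has (fun y => lam y != 0) (T `\ x)%fset); last first.
      rewrite -all_predC => /allP h; move: lam1.
      rewrite big_seq big1 => [/esym/eqP|y /h /=]; first by rewrite oner_eq0.
      by rewrite negbK => /eqP.
    exists y => //.
    have [xy|xy] := eqVneq x y.
      by move: yT; rewrite -xy !inE eqxx.
    have Tx : hull (T `\ x)%fset x by exists lam.
    have ly0 : 0 < lam y by rewrite lt_neqAle eq_sym ly lam0.
    have sE : \sum_(w <- ((T `\ x) `\ y)%fset) lam w = 1 - lam y.
      by rewrite -lam1 (big_fsetD1 y yT) /= addrAC subrr add0r.
    have s0 w : w \in ((T `\ x) `\ y)%fset -> 0 <= lam w.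
      by rewrite !inE => /and3P[_ wx wT]; apply: lam0; rewrite !inE wx.
    have ly1 : lam y <= 1.
      by rewrite -subr_ge0 -sE big_seq sumr_ge0.
    have [l1|l1] := eqVneq (lam y) 1.
      exfalso; move/negP: xy; apply; apply/eqP/eq_from_tnth => j.
      rewrite xE (big_fsetD1 y) //= l1 mul1r big_seq big1 ?addr0 // => w wT.
      have : \sum_(w <- ((T `\ x) `\ y)%fset) lam w = 0 by rewrite sE l1 subrr.
      move/eqP; rewrite big_seq psumr_eq0 // => /allP /(_ w wT).
      by rewrite wT /= => /eqP->; rewrite mul0r.
    have d0 : 1 - lam y != 0 by rewrite subr_eq0 eq_sym.
    exists [tuple (tnth x j - lam y * tnth y j) / (1 - lam y) | j < d], (1 - lam y).
    split; first by rewrite subr_ge0 ly1 ltrBlDr ltrDl ly0.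
      apply: (@hullS ((T `\ x) `\ y)%fset).
        by apply/fsubsetP => w; rewrite !inE => /and3P[].
      exists (fun w => lam w / (1 - lam y)); split=> [w wT|].
        by rewrite divr_ge0 ?s0 // subr_ge0.
      split=> [|j]; first by rewrite -mulr_suml sE divff.
      rewrite tnth_mktuple xE (big_fsetD1 y) //= addrAC subrr add0r mulr_suml.
      by apply: eq_bigr => w _; ring.
    by move=> j; rewrite tnth_mktuple; field.
  move=> y yT [z [a [/andP[a0 a1] Tz xE]]].
  have yx : y <> x by move=> yx; move: yT; rewrite yx !inE eqxx.
  have [a00|a00] := eqVneq a 0.
    by apply: yx; apply/eq_from_tnth => j; rewrite xE a00; ring.
  have yz : y = z.
    apply: (ex y z (1 - a)) => //.
    - by apply: mem_hull; move: yT; rewrite !inE => /andP[].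
    - by rewrite subr_gt0 a1 ltrBlDr ltrDl lt_neqAle eq_sym a00.
    - by move=> j; rewrite xE; ring.
  by apply: yx; apply/eq_from_tnth => j; rewrite xE yz; ring.
split; first exact: mem_hull.
move=> y z l Ty Tz /andP[l0 l1] xE.
have red (u w : V) (m : R) : hull T u -> hull T w -> 0 < m < 1 -> u != x ->
    (forall j, tnth x j = m * tnth u j + (1 - m) * tnth w j) -> False.
  move=> Tu Tw /andP[m0 m1] ux uE; apply: nx.
  have [a [u' [/andP[a0 a1] Tu' u'E]]] := hullD1 xT Tu ux.
  have wx : w != x.
    apply: contra ux => /eqP wx; apply/eqP/eq_from_tnth => j.
    have := uE j; rewrite wx => h.
    by apply: (@mulfI _ m); [rewrite gt_eqF|lra].
  have [b [w' [/andP[b0 b1] Tw' w'E]]] := hullD1 xT Tw wx.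
  (* Substituting the decompositions of [u] and [w] into that of [x] and collecting [x] on the left
     leaves it with the factor [D]. *)
  pose D := m * (1 - a) + (1 - m) * (1 - b).
  have D0 : 0 < D by rewrite /D; nra.
  apply: (@hull_convex _ _ u' w' (m * (1 - a) / D)) => //.
    apply/andP; split; first by rewrite divr_ge0 ?ltW // mulr_gt0 // subr_gt0.
    by rewrite ler_pdivrMr // mul1r /D; nra.
  move=> j; have := uE j; rewrite u'E w'E => h.
  apply: (@mulfI _ D); first by rewrite gt_eqF.
  rewrite [RHS](_ : _ = m * (1 - a) * tnth u' j +
     (1 - m) * (1 - b) * tnth w' j); last by rewrite /D; field; rewrite gt_eqF.
  by rewrite /D; lra.
have [yx|yx] := eqVneq y x; last first.
  by case: (red y z l) => //; rewrite l0.
have [zx|zx] := eqVneq z x; first by rewrite yx zx.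
case: (red z y (1 - l)) => //; first by rewrite subr_gt0 l1 ltrBlDr ltrDl.
by move=> j; rewrite xE; ring.
Qed.

(* On points of [T] this is extremality; the formulation by counts makes it
   jointly measurable in [T] and [x]. *)
Definition vert T x := exists q, Hs q x /\ (pcount T (Hs q) <= 1)%N.

(** A half-space separating [x] from the other points of [T] is one whose only point of [T] is
    [x]. *)
Lemma extreme_vert T x : x \in T -> extreme_point (hull T) x <-> vert T x.
Proof.
move=> xT; rewrite extreme_hullD1 // nhullP; split=> -[q [qx qT]]; exists q.
  split=> //; rewrite /pcount.
  rewrite -(cardfs1 x) fsubset_leq_card //; apply/fsubsetP => y.
  rewrite !inE /= => /andP[yT /asboolP qy].
  by apply: contrapT => /negP yx; apply: (qT y) => //; rewrite !inE yx.
split=> // y; rewrite !inE => /andP[yx yT] qy.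
have : (1 < pcount T (Hs q))%N.
  rewrite /pcount -(_ : #|` [fset x; y]%fset| = 2%N); last first.
    by have xy : x != y; [rewrite eq_sym|rewrite cardfs2 xy].
  apply: fsubset_leq_card; apply/fsubsetP => z; rewrite !inE /=.
  by case/orP => /eqP->; rewrite ?xT ?yT /=; apply/asboolP.
by rewrite ltnNge qT.
Qed.

End Geometry.

(** * Measurability on the space of finite configurations *)

Section Configurations.
Context {R : realType} {d : nat}.
Local Notation V := (d.-tuple R).

HB.instance Definition _ := isPointed.Build {fset V} fset0.

Definition avoids (A : set V) : set {fset V} :=
  [set S : {fset V} | forall y, y \in S -> ~ A y].

Definition voids : set (set {fset V}) := [set avoids A | A in measurable].

(** A map into this space is measurable as soon as the preimages of void events are, which keeps
    unions and insertions of points easy; the price is that counts and hulls must be expressed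
    through void events. *)
Definition config := g_sigma_algebraType voids.
HB.instance Definition _ := Measurable.on config.

Lemma measurable_avoids (A : set V) :
  measurable A -> measurable (avoids A : set config).
Proof. by move=> mA; apply: sub_sigma_algebra; exists A. Qed.

Lemma measurable_to_config dX (X : measurableType dX) (f : X -> config) :
  (forall A, measurable A -> measurable (f @^-1` avoids A)) ->
  measurable_fun setT f.
Proof.
move=> mf; apply: (@measurability _ _ X config setT f voids erefl).
by move=> _ [_ [A mA <-] <-]; rewrite setTI; exact: mf.
Qed.

Lemma avoids_setU A B : avoids (A `|` B) = avoids A `&` avoids B.
Proof.
apply/seteqP; split=> S /=; last by move=> [SA SB] y yS [/SA|/SB]; exact.
by move=> SAB; split=> y yS Ay; apply: (SAB y) => //; [left|right].
Qed.

Lemma measurable_rat_form q : measurable_fun setT (@rat_form R d q).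
Proof.
apply: measurable_funD => //; apply: measurable_sum => j.
by apply: measurable_funM => //; exact: measurable_tnth.
Qed.

Lemma measurable_Hs q : measurable (@Hs R d q).
Proof.
rewrite (_ : Hs q = rat_form q @^-1` `]0, +oo[%classic); last first.
  by apply/seteqP; split=> x; rewrite /Hs /= in_itv /= andbT.
by rewrite -[X in measurable X]setTI; apply: measurable_rat_form.
Qed.

Lemma measurable_nhull :
  measurable [set z : config * V | ~ hull z.1 z.2].
Proof.
rewrite (_ : [set _ | _] = \bigcup_q (avoids (Hs q) `*` Hs q)); last first.
  apply/seteqP; split=> -[S x] /=.
    by move/nhullP => [q [qx qS]]; exists q.
  by case=> q _ /= [qS qx]; apply/nhullP; exists q.
apply: countable_bigcupT_measurable => [|q]; first exact: countableP; apply: measurableX.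
  by apply: measurable_avoids; exact: measurable_Hs.
exact: measurable_Hs.
Qed.

Lemma pcount_le1P (S : {fset V}) A : (pcount S A <= 1)%N <->
  forall x y, x \in S -> y \in S -> A x -> A y -> x = y.
Proof.
split=> [S1 x y xS yS Ax Ay|h].
  move: S1; rewrite /pcount; apply: contraTeq => xy; rewrite -ltnNge.
  rewrite -(_ : #|` [fset x; y]%fset| = 2%N); last by rewrite cardfs2 xy.
  apply: fsubset_leq_card; apply/fsubsetP => z; rewrite !inE /=.
  by case/orP => /eqP->; rewrite ?xS ?yS /=; apply/asboolP.
rewrite /pcount; case: (fset_0Vmem [fset x in S | `[< A x >]]%fset) => [->|[x]].
  by rewrite cardfs0.
rewrite !inE /= => /andP[xS /asboolP Ax].
rewrite -(cardfs1 x) fsubset_leq_card //; apply/fsubsetP => y.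
rewrite !inE /= => /andP[yS /asboolP Ay]; apply/eqP; exact: h.
Qed.

(** Two distinct points differ in some coordinate, where a rational number separates them. So two
    points in [A] are detected by some pair (coordinate, rational) for which both open sides meet
    the configuration inside [A]. *)
Lemma measurable_pcount_le1 (A : set V) : measurable A ->
  measurable [set S : config | (pcount S A <= 1)%N].
Proof.
move=> mA.
pose lo (p : 'I_d * rat) : set V := [set y | tnth y p.1 < ratr p.2].
pose hi (p : 'I_d * rat) : set V := [set y | ratr p.2 < tnth y p.1].
have mlo p : measurable (A `&` lo p).
  apply: measurableI => //.
  rewrite (_ : lo p = (@tnth d R ^~ p.1) @^-1` `]-oo, ratr p.2[%classic).
    by rewrite -[X in measurable X]setTI; apply: measurable_tnth.
  by apply/seteqP; split=> x /=; rewrite in_itv.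
have mhi p : measurable (A `&` hi p).
  apply: measurableI => //.
  rewrite (_ : hi p = (@tnth d R ^~ p.1) @^-1` `]ratr p.2, +oo[%classic).
    by rewrite -[X in measurable X]setTI; apply: measurable_tnth.
  by apply/seteqP; split=> x /=; rewrite in_itv /= andbT.
rewrite (_ : [set _ | _] =
    ~` \bigcup_p (~` avoids (A `&` lo p) `&` ~` avoids (A `&` hi p))).
  apply: measurableC; apply: countable_bigcupT_measurable => [|p]; first exact: countableP.
  by apply: measurableI; apply: measurableC; apply: measurable_avoids.
apply/seteqP; split=> S /=.
  move=> /pcount_le1P h [p _ [/= nlo nhi]].
  apply: nlo => x xS [Ax xlo]; apply: nhi => y yS [Ay yhi].
  have := lt_trans xlo yhi; rewrite (h x y) // ltxx //.
move=> h; apply/pcount_le1P => x y xS yS Ax Ay; apply: contrapT => xy.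
have [j xyj] : exists j, tnth x j != tnth y j.
  apply/existsP; apply: contrapT => /negP; rewrite negb_exists => /forallP e.
  by apply: xy; apply: eq_from_tnth => j; apply/eqP; rewrite -[_ == _]negbK.
wlog xlty : x y xS yS Ax Ay xyj {xy} / tnth x j < tnth y j.
  move=> W; have [xlty|yltx|e] := ltgtP (tnth x j) (tnth y j).
  - exact: (W x y).
  - by apply: (W y x) => //; rewrite eq_sym.
  - by rewrite e eqxx in xyj.
have [r] := rat_in_itvoo xlty; rewrite in_itv /= => /andP[r1 r2].
apply: h; exists (j, r) => //; split=> /= nv.
  exact: (nv x).
exact: (nv y).
Qed.

Lemma measurable_vert : measurable [set z : config * V | vert z.1 z.2].
Proof.
rewrite (_ : [set _ | _] =
    \bigcup_q ([set S : config | (pcount S (Hs q) <= 1)%N] `*` Hs q)).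
  apply: countable_bigcupT_measurable => [|q]; first exact: countableP; apply: measurableX.
    by apply: measurable_pcount_le1; exact: measurable_Hs.
  exact: measurable_Hs.
apply/seteqP; split=> -[S x] /=; first by move=> [q [qx qS]]; exists q.
by case=> q _ /= [qS qx]; exists q.
Qed.

Lemma nvertices_vert (S : {fset V}) :
  nvertices S = #|` [fset x in S | `[< vert S x >]]|%fset.
Proof.
rewrite /nvertices; congr (#|` _|).
apply/fsetP => x; rewrite !inE /=; case xS : (x \in S) => //=.
by apply/asbool_equiv_eq/extreme_vert.
Qed.

(** Each vertex is witnessed by a rational half-space containing it and no other point of [S];
    distinct vertices correspond to half-spaces sharing no point of [S]. The quantifier over [Q] is
    countable, as measurability requires. *)
Lemma leq_nvertices (S : {fset V}) m : (m <= nvertices S)%N <->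
  exists Q : m.-tuple ((d.-tuple rat) * rat),
    (forall i, (pcount S (Hs (tnth Q i)) <= 1)%N /\ ~ avoids (Hs (tnth Q i)) S) /\
    (forall i j, i != j -> avoids (Hs (tnth Q i) `&` Hs (tnth Q j)) S).
Proof.
rewrite nvertices_vert; set W := [fset x in S | _]%fset.
have WP x : x \in W -> x \in S /\ vert S x.
  by rewrite !inE /= => /andP[xS /asboolP].
split=> [mW|[Q [Q1 Q2]]].
  pose p0 : V := [tuple 0 | _ < d].
  pose x (i : 'I_m) : V := nth p0 (enum_fset W) i.
  have iW (i : 'I_m) : (i < size (enum_fset W))%N by exact: leq_trans mW.
  have xW i : x i \in W by rewrite /x; apply: mem_nth.
  have xinj i j : x i = x j -> i = j.
    rewrite /x => /eqP; rewrite nth_uniq ?fset_uniq // => /eqP; exact: val_inj.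
  pose q i := projT1 (cid (WP _ (xW i)).2).
  have qP i : Hs (q i) (x i) /\ (pcount S (Hs (q i)) <= 1)%N.
    by rewrite /q; case: cid.
  exists [tuple q i | i < m]; split=> [i|i j ij]; rewrite !tnth_mktuple.
    have [qi1 qi2] := qP i; split=> // h.
    by apply: (h (x i)) => //; case: (WP _ (xW i)).
  move=> y yS [yi yj]; move/eqP: ij; apply; apply: xinj.
  have xi : x i \in S by case: (WP _ (xW i)).
  have xj : x j \in S by case: (WP _ (xW j)).
  have [qi1 /pcount_le1P qi2] := qP i; have [qj1 /pcount_le1P qj2] := qP j.
  by rewrite (qi2 (x i) y) // (qj2 (x j) y).
have ex i : exists y, y \in S /\ Hs (tnth Q i) y.
  apply: contrapT => ny; apply: (Q1 i).2 => y yS yH; apply: ny.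
  by exists y.
pose y i := projT1 (cid (ex i)).
have yP i : y i \in S /\ Hs (tnth Q i) (y i) by rewrite /y; case: cid.
have yinj : injective y.
  move=> i j yij; apply: contrapT => /eqP ij.
  have [ySi yHi] := yP i; have [_ yHj] := yP j.
  by apply: (Q2 i j ij (y i)) => //; split=> //; rewrite yij.
rewrite -[m in (m <= _)%N]card_ord -(size_image y) cardfE.
rewrite -cardfE; apply: uniq_leq_size; first by rewrite map_inj_uniq ?enum_uniq.
move=> _ /mapP[i _ ->]; have [yS yH] := yP i.
by rewrite !inE /= yS /=; apply/asboolP; exists (tnth Q i); case: (Q1 i).
Qed.

Lemma measurable_nvertices :
  measurable_fun setT (fun S : config => nvertices (S : {fset V})).
Proof.
have mge m : measurable [set S : config | (m <= nvertices (S : {fset V}))%N].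
  rewrite (_ : [set _ | _] = \bigcup_(Q : m.-tuple ((d.-tuple rat) * rat))
    ((\bigcap_(i : 'I_m) ([set S : config | (pcount S (Hs (tnth Q i)) <= 1)%N] `&`
                        ~` avoids (Hs (tnth Q i)))) `&`
     (\bigcap_(p in [set p : 'I_m * 'I_m | p.1 != p.2])
        avoids (Hs (tnth Q p.1) `&` Hs (tnth Q p.2))))).
    apply: countable_bigcupT_measurable => [|Q]; first exact: countableP; apply: measurableI.
      apply: fin_bigcap_measurable => // i _; apply: measurableI.
        by apply: measurable_pcount_le1; exact: measurable_Hs.
      by apply: measurableC; apply: measurable_avoids; exact: measurable_Hs.
    apply: fin_bigcap_measurable => // p _.
    by apply: measurable_avoids; apply: measurableI; exact: measurable_Hs.
  apply/seteqP; split=> S /=.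
    move/leq_nvertices => [Q [Q1 Q2]]; exists Q => //; split=> [i _|[i j] /=].
      exact: Q1.
    exact: Q2.
  move=> [Q _ [/= Q1 Q2]]; apply/leq_nvertices; exists Q; split=> [i|i j ij].
    exact: Q1.
  exact: (Q2 (i, j)).
move=> _ Y _; rewrite setTI.
rewrite (_ : _ @^-1` Y = \bigcup_(n in Y)
   ([set S : config | (n <= nvertices (S : {fset V}))%N] `&`
     ~` [set S : config | (n.+1 <= nvertices (S : {fset V}))%N])).
  by apply: bigcup_measurable => n _; apply: measurableI => //; exact: measurableC.
apply/seteqP; split=> S /=.
  by move=> YS; exists (nvertices (S : {fset V})) => //=; rewrite ltnn.
move=> [n Yn /= [n1 /negP]]; rewrite -leqNgt => n2.
by rewrite (_ : nvertices _ = n) //; apply/eqP; rewrite eqn_leq n2.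
Qed.

Lemma measurable_fsetU1 :
  measurable_fun setT (fun z : config * V => (z.2 |` z.1)%fset : config).
Proof.
apply: measurable_to_config => A mA.
rewrite (_ : _ @^-1` _ = avoids A `*` ~` A).
  by apply: measurableX; [exact: measurable_avoids|exact: measurableC].
apply/seteqP; split=> -[S x] /= h.
  split=> [y yS|]; last by apply: h; rewrite fset1U1.
  by apply: h; rewrite fset1Ur.
by move=> y; rewrite !inE => /orP[/eqP->|]; [exact: h.2|exact: h.1].
Qed.

(** Repeated entries collapse; [PT_not_uniq] later shows that they form a null event. *)
Definition fset_of (s : seq V) : {fset V} := [fset x | x in s]%fset.

Lemma in_fset_of (s : seq V) x : (x \in fset_of s) = (x \in s).
Proof.
apply/imfsetP/idP => [[y /= ys ->]|xs]; first exact: ys.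
by exists x.
Qed.

Lemma measurable_fset_of n :
  measurable_fun setT (fun s : n.-tuple V => fset_of s : config).
Proof.
apply: measurable_to_config => A mA.
rewrite (_ : _ @^-1` _ = \bigcap_(i : 'I_n) ((@tnth n V ^~ i) @^-1` ~` A)).
  apply: fin_bigcap_measurable => // i _.
  rewrite -[X in measurable X]setTI; apply: measurable_tnth => //.
  exact: measurableC.
apply/seteqP; split=> s /= h.
  by move=> i _ /=; apply: h; rewrite in_fset_of mem_tnth.
by move=> y; rewrite in_fset_of => /tnthP[i ->]; exact: h.
Qed.

Lemma measurable_fsetU :
  measurable_fun setT (fun z : config * config => (z.1 `|` z.2)%fset : config).
Proof.
apply: measurable_to_config => A mA.
rewrite (_ : _ @^-1` _ = avoids A `*` avoids A).
  by apply: measurableX; exact: measurable_avoids.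
apply/seteqP; split=> -[S x] /= h.
  by split=> y yS; apply: h; rewrite inE yS ?orbT.
by move=> y; rewrite !inE => /orP[]; [exact: h.1|exact: h.2].
Qed.

End Configurations.

(** * Product measures on tuples *)

Section Indicator.
Context {R : realType}.
Local Open Scope ereal_scope.

(** Taking a proposition instead of a set lets conditions on several integration variables be
    multiplied and rewritten pointwise. *)
Definition ind (P : Prop) : \bar R := (`[< P >]%:R)%:E.

Lemma indT (P : Prop) : P -> ind P = 1.
Proof. by rewrite /ind => /asboolT ->. Qed.

Lemma indF (P : Prop) : ~ P -> ind P = 0.
Proof. by rewrite /ind => /asboolF ->. Qed.

Lemma ind_ge0 (P : Prop) : 0 <= ind P.
Proof. by rewrite /ind lee_fin. Qed.

Lemma ind_le1 (P : Prop) : ind P <= 1.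
Proof. by rewrite /ind lee_fin lern1; case: `[< _ >]. Qed.

Lemma indM (P Q : Prop) : ind P * ind Q = ind (P /\ Q).
Proof.
have [p|p] := pselect P; last first.
  by rewrite (indF p) mul0e indF // => -[].
rewrite (indT p) mul1e; have [q|q] := pselect Q; first by rewrite !indT.
by rewrite (indF q) indF // => -[].
Qed.

Lemma eq_ind (P Q : Prop) : (P <-> Q) -> ind P = ind Q.
Proof. by move=> PQ; rewrite /ind (asbool_equiv_eq PQ). Qed.

Lemma measurable_ind dX (X : measurableType dX) (A : set X) :
  measurable A -> measurable_fun setT (fun x => ind (A x)).
Proof.
move=> mA.
rewrite (_ : (fun x => _) = EFin \o (\1_A : X -> R)).
  exact/measurable_EFinP/measurable_indic.
by apply/funext => x; rewrite /= indicE /ind; congr (_%:R)%:E.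
Qed.

Lemma integral_ind dX (X : measurableType dX) (m : {measure set X -> \bar R})
  (A : set X) : measurable A -> \int[m]_x ind (A x) = m A.
Proof.
move=> mA; have := integral_indic m measurableT mA; rewrite setIT => <-.
by apply: eq_integral => x _; rewrite indicE /ind; congr (_%:R)%:E.
Qed.

Lemma integral_restrict_ind dX (X : measurableType dX)
  (m : {measure set X -> \bar R}) (D : set X) (f : X -> \bar R) :
  \int[m]_(x in D) f x = \int[m]_x (ind (D x) * f x).
Proof.
rewrite integral_mkcond; apply: eq_integral => x _; rewrite /patch.
case: ifPn => [/set_mem Dx|/negP nDx]; first by rewrite indT ?mul1e.
by rewrite indF ?mul0e // => Dx; apply: nDx; rewrite inE.
Qed.

End Indicator.

Section ProductMeasure.
Context {R : realType} {d : nat}.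
Local Notation V := (d.-tuple R).
Variable mu : probability V R.
Local Open Scope ereal_scope.

Definition cons_tup n (z : V * n.-tuple V) : n.+1.-tuple V :=
  [tuple of z.1 :: z.2].

Lemma measurable_cons_tup n : measurable_fun setT (@cons_tup n).
Proof. exact: measurable_cons. Qed.

HB.instance Definition _ n :=
  isMeasurableFun.Build _ _ _ _ (@cons_tup n) (@measurable_cons_tup n).

(** The law of [n] independent [mu]-distributed points, with the same recursion as [iter_int]. *)
Fixpoint PT n : probability (n.-tuple V) R :=
  match n with
  | 0 => dirac [tuple]
  | n'.+1 => distribution (mu \x PT n') (@cons_tup n')
  end.

Lemma measurable_to_tuple0 dX (X : measurableType dX) (f : 0.-tuple V -> X) :
  measurable_fun setT f.
Proof.
move=> _ Y _; rewrite setTI.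
have [fY|fY] := pselect (Y (f [tuple])).
  by rewrite (_ : _ @^-1` _ = setT) //; apply/seteqP; split=> // s _ /=;
     rewrite tuple0.
by rewrite (_ : _ @^-1` _ = set0) //; apply/seteqP; split=> // s /=;
     rewrite tuple0.
Qed.

Lemma integral_PT0 (f : 0.-tuple V -> \bar R) :
  \int[PT 0]_s f s = f [tuple].
Proof.
rewrite /= integral_dirac //; first by rewrite diracT mul1e.
exact: measurable_to_tuple0.
Qed.

Lemma integral_PTS n (f : n.+1.-tuple V -> \bar R) :
  measurable_fun setT f -> (forall s, 0 <= f s) ->
  \int[PT n.+1]_s f s = \int[mu]_x \int[PT n]_s f (cons_tup (x, s)).
Proof.
move=> mf f0; rewrite /= ge0_integral_distribution // fubini_tonelli1 //; last by move=> z; exact: f0.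
apply: measurableT_comp => //; exact: measurable_cons_tup.
Qed.

Lemma measurable_integral_param dX dY (X : measurableType dX) (Y : measurableType dY)
  (m : probability Y R) (f : X -> Y -> \bar R) :
  measurable_fun setT (fun z : X * Y => f z.1 z.2) ->
  (forall x y, 0 <= f x y) ->
  measurable_fun setT (fun x => \int[m]_y f x y).
Proof.
move=> mf f0.
exact: (@measurable_fun_fubini_tonelli_F _ _ X Y R m (fun z => f z.1 z.2)).
Qed.

Lemma integral_swap dX dY (X : measurableType dX) (Y : measurableType dY)
  (m1 : probability X R) (m2 : probability Y R) (f : X -> Y -> \bar R) :
  measurable_fun setT (fun z : X * Y => f z.1 z.2) ->
  (forall x y, 0 <= f x y) ->
  \int[m1]_x \int[m2]_y f x y = \int[m2]_y \int[m1]_x f x y.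
Proof.
move=> mf f0.
exact: (@fubini_tonelli _ _ X Y R m1 m2 (fun z => f z.1 z.2)).
Qed.

Lemma measurable_comp2 dX dY dZ (X : measurableType dX) (Y : measurableType dY)
  (Z : measurableType dZ) dW (W : measurableType dW)
  (f : Y * Z -> W) (g : X -> Y) (h : X -> Z) :
  measurable_fun setT f -> measurable_fun setT g -> measurable_fun setT h ->
  measurable_fun setT (fun x => f (g x, h x)).
Proof.
move=> mf mg mh; apply: (measurableT_comp mf).
exact: measurable_fun_pair.
Qed.

Lemma measurable_all n (D : set V) : measurable D ->
  measurable [set s : n.-tuple V | forall x, x \in (s : seq V) -> D x].
Proof.
move=> mD.
rewrite (_ : [set _ | _] = \bigcap_(i : 'I_n) ((@tnth n V ^~ i) @^-1` D)).
  apply: fin_bigcap_measurable => // i _.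
  by rewrite -[X in measurable X]setTI; apply: measurable_tnth.
apply/seteqP; split=> s /= h.
  by move=> i _ /=; apply: h; exact: mem_tnth.
by move=> y /tnthP[i ->]; exact: h.
Qed.

Lemma measurable_ind_all n (D : set V) : measurable D ->
  measurable_fun setT (fun s : n.-tuple V =>
    ind (forall x, x \in (s : seq V) -> D x) : \bar R).
Proof. by move=> mD; exact: (measurable_ind (@measurable_all n D mD)). Qed.

Lemma iter_int_PT n (D : set V) (g : seq V -> \bar R) : measurable D ->
  (forall s, 0 <= g s) ->
  measurable_fun setT (fun s : n.-tuple V => g s) ->
  iter_int mu D n g =
    \int[PT n]_s (ind (forall x, x \in (s : seq V) -> D x) * g s).
Proof.
move=> mD; elim: n g => [|n IH] g g0 mg.
  by rewrite integral_PT0 /= indT ?mul1e.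
rewrite integral_PTS; last 2 first.
- by apply: emeasurable_funM => //; exact: measurable_ind_all.
- by move=> s; rewrite mule_ge0 ?ind_ge0.
rewrite [LHS]/= integral_restrict_ind; apply: eq_integral => x _.
have mgx : measurable_fun setT (fun s : n.-tuple V => g (x :: s)).
  have mc : measurable_fun setT (fun s : n.-tuple V => cons_tup (x, s)).
    exact: (measurableT_comp (@measurable_cons_tup n) (pair1_measurable x)).
  exact: (measurableT_comp mg mc).
rewrite IH // -ge0_integralZl //; last 3 first.
- by apply: emeasurable_funM => //; exact: measurable_ind_all.
- by move=> s _; rewrite mule_ge0 ?ind_ge0.
- exact: ind_ge0.
apply: eq_integral => s _; rewrite muleA indM; congr (_ * _).
apply: eq_ind; split=> [[Dx Ds] y|h].
  by rewrite inE => /orP[/eqP->//|]; exact: Ds.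
by split=> [|y ys]; apply: h; rewrite inE ?eqxx ?ys ?orbT.
Qed.

Definition rem_tup n (i : 'I_n.+1) (s : n.+1.-tuple V) : n.-tuple V :=
  [tuple tnth s (lift i j) | j < n].

Lemma measurable_rem_tup n (i : 'I_n.+1) : measurable_fun setT (rem_tup i).
Proof.
apply/measurable_fun_tnthP => j.
rewrite (_ : _ \o _ = @tnth _ V ^~ (lift i j)); first exact: measurable_tnth.
by apply/funext => s /=; rewrite tnth_mktuple.
Qed.

(** This is exchangeability: any coordinate may play the role of the first. By induction, entry [i]
    is brought to the front of the tail and then exchanged with the head by Tonelli's theorem. *)
Lemma integral_PT_extract n (i : 'I_n.+1) (f : V -> n.-tuple V -> \bar R) :
  measurable_fun setT (fun z : V * n.-tuple V => f z.1 z.2) ->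
  (forall x s, 0 <= f x s) ->
  \int[PT n.+1]_s f (tnth s i) (rem_tup i s) =
  \int[mu]_x \int[PT n]_s f x s.
Proof.
have mext m (j : 'I_m.+1) (g : V -> m.-tuple V -> \bar R) :
    measurable_fun setT (fun z : V * m.-tuple V => g z.1 z.2) ->
    measurable_fun setT (fun s => g (tnth s j) (rem_tup j s)).
  move=> mg; apply: (measurable_comp2 mg); first exact: measurable_tnth.
  exact: measurable_rem_tup.
elim: n i f => [|n IH] i f mf f0.
  rewrite integral_PTS; [|exact: mext|by move=> s; exact: f0].
  apply: eq_integral => x _; rewrite !integral_PT0; congr (f _ _).
    by rewrite (ord1 i).
  by rewrite [LHS]tuple0.
rewrite integral_PTS; [|exact: mext|by move=> s; exact: f0].
case: (unliftP ord0 i) => [i' ->|->]; last first.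
  apply: eq_integral => x _; apply: eq_integral => s _; congr (f _ _).
  by apply: eq_from_tnth => j; rewrite tnth_mktuple tnthS.
(* Here [y] is the head of the tuple and [x] the extracted entry. *)
transitivity (\int[mu]_y \int[mu]_x \int[PT n]_s f x (cons_tup (y, s))).
  apply: eq_integral => y _.
  rewrite -(IH i' (fun x s => f x (cons_tup (y, s)))) //; last first.
    apply: (measurable_comp2 mf) => //.
    exact: (measurable_comp2 (@measurable_cons_tup n)).
  apply: eq_integral => s _; congr (f _ _); first by rewrite tnthS.
  apply: eq_from_tnth => j; rewrite tnth_mktuple.
  case: (unliftP ord0 j) => [j' ->|->].
    rewrite [RHS]tnthS tnth_mktuple.
    rewrite (_ : lift (lift ord0 i') (lift ord0 j') = lift ord0 (lift i' j')).
      by rewrite [LHS]tnthS.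
    by apply/val_inj; rewrite /= /bump /= !add1n ltnS addnS.
  by rewrite (_ : lift (lift ord0 i') ord0 = ord0) //; exact/val_inj.
rewrite integral_swap.
- apply: eq_integral => x _; rewrite integral_PTS //.
  exact: (@measurable_fun_pair2 _ _ _ _ _ _ (fun z => f z.1 z.2)).
- apply: (@measurable_integral_param _ _ _ _ _
    (fun (z : V * V) (s : n.-tuple V) => f z.2 (cons_tup (z.1, s)))) => //.
  apply: (measurable_comp2 mf); first by apply: measurableT_comp.
  apply: (measurable_comp2 (@measurable_cons_tup n)) => //.
  exact: measurableT_comp.
- by move=> y x; apply: integral_ge0.
Qed.

End ProductMeasure.

(** * The law of a Poisson process *)

Section PoissonLaw.
Context {R : realType} {d : nat}.
Local Notation V := (d.-tuple R).
Variables (mu : probability V R) (t : R).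
Hypothesis t_gt0 : 0 < t.
Local Open Scope ereal_scope.

Definition poisson_weight n : R := (expR (- t) * t ^+ n / n`!%:R)%R.

Lemma poisson_weight_ge0 n : (0 <= poisson_weight n)%R.
Proof.
by rewrite /poisson_weight divr_ge0 // mulr_ge0 ?expR_ge0 // exprn_ge0 // ltW.
Qed.

Lemma poisson_weight_ffact m k : (k <= m)%N ->
  (poisson_weight m * (m ^_ k)%:R = t ^+ k * poisson_weight (m - k))%R.
Proof.
move=> km; rewrite /poisson_weight.
have e : ((m ^_ k)%:R * (m - k)`!%:R = m`!%:R :> R)%R.
  by rewrite -natrM ffact_fact.
have f0 n : (n`!%:R != 0 :> R)%R by rewrite pnatr_eq0 -lt0n fact_gt0.
rewrite -{1}(subnK km) exprD -e; field.
rewrite f0 /=; apply/eqP => h; have := f0 m; rewrite -e h mul0r eqxx //.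
Qed.

(** The generating function of the Poisson distribution; at [q = 1 - mu A] it yields the void
    probability of [A]. *)
Lemma nneseries_poisson_weight (q : R) : (0 <= q)%R ->
  \sum_(n <oo) (poisson_weight n * q ^+ n)%:E = (expR (t * q - t))%:E.
Proof.
move=> q0.
have E n : (poisson_weight n * q ^+ n = expR (- t) * exp_coeff (t * q) n)%R.
  by rewrite /poisson_weight /exp_coeff /= exprMn; field;
     rewrite pnatr_eq0 -lt0n fact_gt0.
transitivity (limn (EFin \o (fun n : nat =>
    expR (- t) * series (exp_coeff (t * q)) n)%R)).
  congr (limn _); apply/funext => n /=.
  rewrite /series /= mulr_sumr -sumEFin; apply: eq_bigr => i _; by rewrite E.
have cv : cvgn (fun n : nat => (expR (- t) * series (exp_coeff (t * q)) n)%R).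
  by apply: is_cvgMr; exact: is_cvg_series_exp_coeff.
rewrite EFin_lim //; congr EFin.
rewrite limM //; [|exact: is_cvg_cst|exact: is_cvg_series_exp_coeff].
by rewrite lim_cst // addrC expRD.
Qed.

Lemma PT_all n (D : set V) : measurable D ->
  PT mu n [set s : n.-tuple V | forall x, x \in (s : seq V) -> D x] = mu D ^+ n.
Proof.
move=> mD; rewrite -integral_ind; last exact: measurable_all.
transitivity (iter_int mu D n (fun=> 1)).
  rewrite iter_int_PT //; apply: eq_integral => s _.
  by rewrite mule1.
elim: n => [|n IH]; first by rewrite expe0.
have -> : iter_int mu D n.+1 (fun=> 1) =
  \int[mu]_(x in D) iter_int mu D n (fun=> 1) by [].
by rewrite IH (integral_cst _ mD (mu D ^+ n)) expeS muleC.
Qed.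

Lemma avoidsE (A : set V) (S : {fset V}) : avoids A S <-> pcount S A = 0%N.
Proof.
rewrite /avoids /pcount; split=> [SA|/eqP].
  apply/eqP; rewrite cardfs_eq0; apply/eqP/fsetP => x; rewrite !inE /=.
  by apply/negP => /andP[/SA nA /asboolP].
rewrite cardfs_eq0 => /eqP e x xS Ax.
have : x \in [fset x in S | `[< A x >]]%fset.
  by rewrite !inE /= xS; apply/asboolP.
by rewrite e inE.
Qed.

Lemma setI_closed_voids : setI_closed (@voids R d).
Proof.
move=> _ _ [A mA <-] [B mB <-]; exists (A `|` B); last by rewrite avoids_setU.
exact: measurableU.
Qed.

Definition fset_tup n (s : n.-tuple V) : @config R d := fset_of s.

Lemma measurable_fset_tup n : measurable_fun setT (@fset_tup n).
Proof. exact: measurable_fset_of. Qed.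

HB.instance Definition _ n :=
  isMeasurableFun.Build _ _ _ _ (@fset_tup n) (@measurable_fset_tup n).

Definition poisson_component n : {measure set (@config R d) -> \bar R} :=
  mscale (NngNum (poisson_weight_ge0 n)) (distribution (PT mu n) (@fset_tup n)).

Definition poisson_law : {measure set (@config R d) -> \bar R} :=
  mseries poisson_component 0.

Lemma poisson_law_void (A : set V) : measurable A ->
  poisson_law (avoids A) = (expR (- (t * fine (mu A))))%:E.
Proof.
move=> mA; have mAC : measurable (~` A) by exact: measurableC.
have muA : mu (~` A) = (1 - fine (mu A))%:E.
  by rewrite probability_setC // EFinB fineK // fin_num_measure.
have muA0 : (0 <= 1 - fine (mu A))%R by rewrite -lee_fin -muA.
transitivity (\sum_(n <oo) (poisson_weight n * (1 - fine (mu A)) ^+ n)%:E).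
  apply: eq_eseriesr => n _; rewrite /poisson_component /mscale /=.
  rewrite EFinM; congr (_ * _).
  rewrite EFin_expe -muA -PT_all //; congr (PT _ _ _).
  apply/seteqP; split=> s /= h x xs; first by apply: h; rewrite in_fset_of.
  by apply: h; rewrite in_fset_of in xs.
by rewrite nneseries_poisson_weight //; congr (expR _)%:E; ring.
Qed.

End PoissonLaw.

Section PoissonProcess.
Context {R : realType} {d : nat}.
Local Notation V := (d.-tuple R).
Variables (mu : probability V R) (t : R).
Hypothesis t_gt0 : 0 < t.
Context {dO : measure_display} {Omega : measurableType dO}.
Variables (P : probability Omega R) (eta : Omega -> {fset V}).
Hypothesis eta_PPP : is_PPP P t mu eta.
Local Open Scope ereal_scope.

Lemma measurable_eta : measurable_fun setT (eta : Omega -> @config R d).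
Proof.
apply: measurable_to_config => A mA.
rewrite (_ : _ @^-1` _ = [set w | pcount (eta w) A = 0%N]).
  by case: eta_PPP => + _; exact.
by apply/seteqP; split=> w /= /avoidsE.
Qed.

Let etam : {mfun Omega >-> @config R d} :=
  HB.pack (eta : Omega -> @config R d)
    (isMeasurableFun.Build _ _ _ _ (eta : Omega -> @config R d) measurable_eta).

(* Renyi: the void probabilities determine the law of [eta]. *)
Lemma expectation_eta (f : @config R d -> \bar R) : measurable_fun setT f ->
  (forall S, 0 <= f S) ->
  \int[P]_w f (eta w) =
  \sum_(n <oo) (poisson_weight t n)%:E * \int[PT mu n]_s f (fset_tup s).
Proof.
move=> mf f0.
transitivity (\int[distribution P etam]_S f S).
  by rewrite ge0_integral_distribution.
rewrite (@eq_measure_integral _ _ _ _ (poisson_law mu t_gt0)); last first.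
  move=> A mA _.
  (* Uniqueness of finite measures on an intersection-stable generator; the whole space is itself
     the void event of [set0]. *)
  apply: (@measure_unique _ R (@config R d) (@voids R d) (fun=> setT) erefl _ _ _
    (distribution P etam) (poisson_law mu t_gt0)) => //.
  - exact: setI_closed_voids.
  - by move=> _; exists set0 => //; apply/seteqP; split=> // S _ y _.
  - by rewrite bigcup_const.
  - move=> _ [B mB <-]; rewrite [RHS]poisson_law_void //.
    transitivity (P [set w | pcount (eta w) B = 0%N]); last first.
      case: eta_PPP => _ [-> // _]; congr EFin.
      by rewrite /poisson_p expr0 mulr1 fact0 divr1.
    congr (P _).
    by apply/seteqP; split=> w /= /avoidsE.
  - move=> _; exact: le_lt_trans
      (probability_le1 (distribution P etam) measurableT) (ltry 1).
rewrite ge0_integral_measure_series //; apply: eq_eseriesr => n _.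
by rewrite ge0_integral_mscale // ge0_integral_distribution.
Qed.

Lemma measurable_set1_tuple (x : V) : measurable [set x].
Proof.
rewrite (_ : [set x] = \bigcap_(i : 'I_d) ((@tnth d R ^~ i) @^-1` [set tnth x i])).
  apply: fin_bigcap_measurable => // i _.
  by rewrite -[X in measurable X]setTI; apply: measurable_tnth.
apply/seteqP; split=> [y -> i _ //|y h].
by apply: eq_from_tnth => i; exact: h.
Qed.

(* A set of points has at most one point at [x], but a Poisson variable with
   positive mean takes the value 2 with positive probability. *)
Lemma intensity_diffuse (x : V) : mu [set x] = 0.
Proof.
have mx := measurable_set1_tuple x.
have := eta_PPP.2.1 _ mx 2%N.
rewrite (_ : [set w | _] = set0); last first.
  apply/seteqP; split=> // w /= h.
  have : (pcount (eta w) [set x] <= 1)%N.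
    by apply/pcount_le1P => y z _ _ /= -> ->.
  by rewrite h.
rewrite measure0 => /esym [] /eqP.
rewrite /poisson_p !mulf_eq0 expR_eq0 invr_eq0 pnatr_eq0 /= orbF.
rewrite (gt_eqF t_gt0) /= ?orbF orbb => /eqP m0.
by rewrite -(fineK (fin_num_measure mu _ mx)) m0.
Qed.

End PoissonProcess.

(** * Measurability of configuration functionals along measurable maps *)

Section Composed.
Context {R : realType} {d : nat}.
Local Notation V := (d.-tuple R).
Local Notation config := (@config R d).
Context {dX : measure_display} {X : measurableType dX}.
Implicit Types (f g : X -> config) (x : X -> V).
Local Open Scope ereal_scope.

Lemma measurable_vert_comp f x : measurable_fun setT f -> measurable_fun setT x ->
  measurable [set w | vert (f w) (x w)].
Proof.
move=> mf mx; rewrite -[X in measurable X]setTI.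
exact: (measurable_fun_pair mf mx measurableT measurable_vert).
Qed.

Lemma measurable_nhull_comp f x : measurable_fun setT f -> measurable_fun setT x ->
  measurable [set w | ~ hull (f w) (x w)].
Proof.
move=> mf mx; rewrite -[X in measurable X]setTI.
exact: (measurable_fun_pair mf mx measurableT measurable_nhull).
Qed.

Lemma measurable_fsetU_comp f g : measurable_fun setT f -> measurable_fun setT g ->
  measurable_fun setT (fun w => (f w `|` g w)%fset : config).
Proof. by move=> mf mg; exact: (measurable_comp2 measurable_fsetU). Qed.

Lemma measurable_fsetU1_comp f x : measurable_fun setT f -> measurable_fun setT x ->
  measurable_fun setT (fun w => (x w |` f w)%fset : config).
Proof. by move=> mf mx; exact: (measurable_comp2 measurable_fsetU1). Qed.

Lemma measurable_fset_of_comp n (s : X -> n.-tuple V) : measurable_fun setT s ->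
  measurable_fun setT (fun w => fset_of (s w) : config).
Proof. by move=> ms; exact: (measurableT_comp (@measurable_fset_of R d n) ms). Qed.

Lemma measurable_tnth_comp n (s : X -> n.-tuple V) i : measurable_fun setT s ->
  measurable_fun setT (fun w => tnth (s w) i).
Proof. by move=> ms; exact: (measurableT_comp (measurable_tnth i) ms). Qed.

Lemma measurable_cons_comp n x (s : X -> n.-tuple V) :
  measurable_fun setT x -> measurable_fun setT s ->
  measurable_fun setT (fun w => cons_tup (x w, s w)).
Proof. by move=> mx ms; exact: (measurable_comp2 (@measurable_cons_tup R d n)). Qed.

Lemma measurable_forall_ord n (A : 'I_n -> X -> Prop) :
  (forall i, measurable [set w | A i w]) ->
  measurable [set w | forall i, A i w].
Proof.
move=> mA; rewrite (_ : [set _ | _] = \bigcap_i [set w | A i w]).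
  by apply: fin_bigcap_measurable.
by apply/seteqP; split=> w /= h i; [move=> _; exact: h|exact: (h i I)].
Qed.

Lemma measurable_allin n (s : X -> n.-tuple V) (A : X -> V -> Prop) :
  (forall i, measurable [set w | A w (tnth (s w) i)]) ->
  measurable [set w | forall y, y \in (s w : seq V) -> A w y].
Proof.
move=> mA; rewrite (_ : [set _ | _] = [set w | forall i, A w (tnth (s w) i)]).
  exact: measurable_forall_ord.
apply/seteqP; split=> w /= h; first by move=> i; apply: h; exact: mem_tnth.
by move=> y /tnthP[i ->].
Qed.

Lemma measurable_eq_comp x (y : X -> V) : measurable_fun setT x ->
  measurable_fun setT y -> measurable [set w | x w = y w].
Proof.
move=> mx my.
rewrite (_ : [set _ | _] = [set w | forall j, tnth (x w) j = tnth (y w) j]).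
  apply: measurable_forall_ord => j.
  have hx : measurable_fun setT (fun w => tnth (x w) j).
    exact: (measurableT_comp (measurable_tnth j) mx).
  have hy : measurable_fun setT (fun w => tnth (y w) j).
    exact: (measurableT_comp (measurable_tnth j) my).
  have := measurable_fun_eqr hx hy.
  move=> /(_ measurableT [set true] I); rewrite setTI.
  by congr measurable; apply/seteqP; split=> w /= /eqP.
by apply/seteqP; split=> w /= => [-> //|]; exact: eq_from_tnth.
Qed.

Lemma measurable_uniq_comp n (s : X -> n.-tuple V) : measurable_fun setT s ->
  measurable [set w | uniq (s w)].
Proof.
move=> ms; rewrite (_ : [set _ | _] =
  \bigcap_(p in [set p : 'I_n * 'I_n | p.1 != p.2])
     ~` [set w | tnth (s w) p.1 = tnth (s w) p.2]).
  apply: fin_bigcap_measurable => // p _; apply: measurableC.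
  by apply: measurable_eq_comp; exact: measurable_tnth_comp.
apply/seteqP; split=> w /=.
  by move=> /tuple_uniqP inj [i j] /= ij /inj /eqP; exact/negP.
move=> h; apply/tuple_uniqP => i j eij; apply: contrapT => /eqP ij.
exact: (h (i, j) ij).
Qed.

(** Positions are counted with multiplicity, so that a single index can be split off; on
    duplicate-free lists this agrees with [nvertices]. *)
Definition vertc (T : {fset V}) (s : seq V) : nat :=
  count (fun y : V => `[< vert T y >]) s.

Lemma measurable_nat_comp (c : X -> nat) (h : nat -> \bar R) :
  measurable_fun setT c -> measurable_fun setT (fun w => h (c w)).
Proof. by move=> mc; apply: (measurableT_comp _ mc). Qed.

Lemma measurable_vertc_comp f n (s : X -> n.-tuple V) :
  measurable_fun setT f -> measurable_fun setT s ->
  measurable_fun setT (fun w => vertc (f w) (s w)).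
Proof.
move=> mf ms.
rewrite (_ : (fun w => _) =
  (fun w => \sum_(i < n) nat_of_bool `[< vert (f w) (tnth (s w) i) >])%N); last first.
  by apply/funext => w; rewrite /vertc -sum1_count big_tuple big_mkcond.
elim: (index_enum _) => [|i r IH].
  by rewrite (_ : (fun w => _) = cst 0%N) //; apply/funext => w; rewrite big_nil.
rewrite (_ : (fun w => _) = (fun w => nat_of_bool `[< vert (f w) (tnth (s w) i) >] +
  (\sum_(i <- r) nat_of_bool `[< vert (f w) (tnth (s w) i) >])%N)%N); last first.
  by apply/funext => w; rewrite big_cons.
apply: measurable_fun_addn => //.
have mv : measurable_fun setT (fun w => `[< vert (f w) (tnth (s w) i) >]).
  apply: (measurable_fun_bool true); rewrite setTI.
  have := measurable_vert_comp mf (measurable_tnth_comp i ms).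
  by congr measurable; apply/seteqP; split=> w /= /asboolP.
exact: (measurableT_comp (_ : measurable_fun setT nat_of_bool) mv).
Qed.

End Composed.

(** * Factorial moments of the number of vertices *)

Section Recursions.
Context {R : realType} {d : nat}.
Local Notation V := (d.-tuple R).
Local Notation config := (@config R d).
Variable mu : probability V R.
Hypothesis mu_diffuse : forall x, mu [set x] = 0%E.
Local Open Scope ereal_scope.

Lemma integral_prob_cst dX (X : measurableType dX) (m : probability X R) (c : \bar R) :
  \int[m]_x c = c.
Proof.
apply: (etrans (integral_cst m measurableT c)).
exact: (etrans (congr1 (mule c) (probability_setT m)) (mule1 c)).
Qed.

Lemma measurable_mem_seq (s : seq V) : measurable [set x | x \in s].
Proof.
elim: s => [|a s IH].
  by rewrite (_ : [set x | _] = set0) //; apply/seteqP; split=> x //=;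
     rewrite in_nil.
rewrite (_ : [set x | _] = [set a] `|` [set x | x \in s]).
  by apply: measurableU => //; exact: measurable_set1_tuple.
by apply/seteqP; split=> x /=; rewrite inE => /predU1P.
Qed.

Lemma measure_mem_seq (s : seq V) : mu [set x | x \in s] = 0.
Proof.
elim: s => [|a s IH].
  rewrite (_ : [set x | _] = set0) ?measure0 //.
  by apply/seteqP; split=> x //=; rewrite in_nil.
rewrite (_ : [set x | _] = [set a] `|` [set x | x \in s]); last first.
  by apply/seteqP; split=> x /=; rewrite inE => /predU1P.
apply/eqP; rewrite -measure_le0.
have := measureU2 mu (measurable_set1_tuple a) (measurable_mem_seq s).
by rewrite [X in _ <= X + _](mu_diffuse a) [X in _ <= _ + X]IH adde0.
Qed.

(** Diffuseness makes finite lists negligible, so a new point may be taken distinct from those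
    already present. *)
Lemma eq_integral_off_seq (s : seq V) (f g : V -> \bar R) :
  measurable_fun setT f -> measurable_fun setT g ->
  (forall x, 0 <= f x) -> (forall x, 0 <= g x) ->
  (forall x, x \notin s -> f x = g x) ->
  \int[mu]_x f x = \int[mu]_x g x.
Proof.
move=> mf mg f0 g0 fg; apply: ge0_ae_eq_integral => //.
exists [set x | x \in s]; split=> [||x /= nfg].
- exact: measurable_mem_seq.
- exact: measure_mem_seq.
- by apply: contrapT => /negP xs; apply: nfg => _; exact: fg.
Qed.

(** Integrating over the head with the tail fixed, the head hits the tail only on a null set. *)
Lemma PT_not_uniq n : \int[PT mu n]_s ind (~ uniq (s : seq V)) = 0.
Proof.
have mu_ dX (X : measurableType dX) m (s : X -> m.-tuple V) :
    measurable_fun setT s ->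
    measurable_fun setT (fun w => ind (~ uniq (s w)) : \bar R).
  by move=> ms; apply: measurable_ind; apply: measurableC;
     exact: measurable_uniq_comp.
elim: n => [|n IH].
  by rewrite integral_PT0 indF // => /(_ isT).
rewrite integral_PTS; [|exact: mu_|by move=> s; exact: ind_ge0].
rewrite integral_swap; last 2 first.
- by apply: mu_; apply: measurable_cons_comp.
- by move=> x y; exact: ind_ge0.
rewrite -[RHS]IH; apply: eq_integral => s _.
transitivity (\int[mu]_x ind (~ uniq (s : seq V))); last first.
  by rewrite integral_prob_cst.
apply: (@eq_integral_off_seq s) => //.
- apply: mu_; apply: measurable_cons_comp => //.
- by move=> x; exact: ind_ge0.
- by move=> x; exact: ind_ge0.
- by move=> x xs; apply: eq_ind => /=; rewrite xs.
Qed.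

Lemma vertc_nvertices (s : seq V) : uniq s ->
  vertc (fset_of s) s = nvertices (fset_of s).
Proof.
move=> us; rewrite nvertices_vert /vertc -size_filter.
apply: perm_size; apply: uniq_perm => [||x]; first exact: filter_uniq.
  exact: fset_uniq.
by rewrite mem_filter !inE andbC.
Qed.

Definition allv (T : {fset V}) (s : seq V) : Prop := forall y, y \in s -> vert T y.

(* [n] points known to be vertices, [m] further points carrying a factorial
   power of the number of vertices among them. *)
Definition Lint n m k : \bar R :=
  \int[PT mu n]_ys \int[PT mu m]_s
    (ind (allv (fset_of ys `|` fset_of s)%fset ys) *
     ((vertc (fset_of ys `|` fset_of s)%fset s) ^_ k)%:R%:E).

Lemma measurable_ind_allv_comp dX (X : measurableType dX) (f : X -> config) n
  (s : X -> n.-tuple V) : measurable_fun setT f -> measurable_fun setT s ->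
  measurable_fun setT (fun w => ind (allv (f w) (s w)) : \bar R).
Proof.
move=> mf ms; apply: measurable_ind.
apply: (@measurable_allin _ _ _ X n s (fun w y => vert (f w) y)) => i.
by apply: measurable_vert_comp => //; exact: measurable_tnth_comp.
Qed.

Lemma measurable_ind_vert_comp dX (X : measurableType dX) (f : X -> config)
  (x : X -> V) : measurable_fun setT f -> measurable_fun setT x ->
  measurable_fun setT (fun w => ind (vert (f w) (x w)) : \bar R).
Proof. by move=> mf mx; apply: measurable_ind; exact: measurable_vert_comp. Qed.

Lemma measurable_ffact_vertc_comp dX (X : measurableType dX) (f : X -> config) n
  (s : X -> n.-tuple V) k : measurable_fun setT f -> measurable_fun setT s ->
  measurable_fun setT (fun w => ((vertc (f w) (s w)) ^_ k)%:R%:E : \bar R).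
Proof.
move=> mf ms.
apply: (@measurable_nat_comp _ _ _ (fun w => vertc (f w) (s w))
  (fun c => (c ^_ k)%:R%:E)).
exact: measurable_vertc_comp.
Qed.

Lemma fset_of_cons (x : V) (s : seq V) : fset_of (x :: s) = (x |` fset_of s)%fset.
Proof. by apply/fsetP => y; rewrite !inE. Qed.

Lemma fset_of_rem n (i : 'I_n.+1) (s : n.+1.-tuple V) :
  fset_of s = (tnth s i |` fset_of (rem_tup i s))%fset.
Proof.
apply/fsetP => y; rewrite !inE.
apply/tnthP/orP => [[j ->]|[/eqP->|/tnthP[j ->]]].
- case: (unliftP i j) => [j' ->|->]; last by left.
  by right; apply/tnthP; exists j'; rewrite tnth_mktuple.
- by exists i.
- by exists (lift i j); rewrite tnth_mktuple.
Qed.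

Lemma vertc_rem (T : {fset V}) n (i : 'I_n.+1) (s : n.+1.-tuple V) :
  vertc T s = (`[< vert T (tnth s i) >] + vertc T (rem_tup i s))%N.
Proof.
rewrite /vertc -!sum1_count !big_tuple !(big_mkcond (fun y => `[< _ >])) /=.
rewrite (bigD1_ord i) //=; congr (_ + _)%N.
by apply: eq_bigr => j _; rewrite tnth_mktuple.
Qed.

Lemma measurable_Lint_integrand n m k : measurable_fun setT
  (fun ys : n.-tuple V => \int[PT mu m]_s
    (ind (allv (fset_of ys `|` fset_of s)%fset ys) *
     ((vertc (fset_of ys `|` fset_of s)%fset s) ^_ k)%:R%:E)).
Proof.
apply: (measurable_integral_param (PT mu m) (f := fun (ys : n.-tuple V) (s : m.-tuple V) =>
  (ind (allv (fset_of ys `|` fset_of s)%fset ys) *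
     ((vertc (fset_of ys `|` fset_of s)%fset s) ^_ k)%:R%:E))); last first.
  by move=> ys s; rewrite mule_ge0 ?ind_ge0.
have mT : measurable_fun setT (fun z : n.-tuple V * m.-tuple V =>
    (fset_of z.1 `|` fset_of z.2)%fset : config).
  by apply: measurable_fsetU_comp; exact: measurable_fset_of_comp.
apply: emeasurable_funM; first exact: measurable_ind_allv_comp.
exact: measurable_ffact_vertc_comp.
Qed.

Lemma Lint0 n k : Lint n 0 k.+1 = 0.
Proof.
rewrite /Lint integral0_eq // => ys _; rewrite integral_PT0 /=.
by rewrite /vertc /= ffact0n mule0.
Qed.

(** One factor of the factorial power is a sum over the indices of points that are vertices. The
    selected point joins the known vertices, and by exchangeability all [m.+1] indices contribute
    equally. *)
Lemma LintS n m k : Lint n m.+1 k.+1 = m.+1%:R%:E * Lint n.+1 m k.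
Proof.
pose T (ys : seq V) x (s : seq V) := (x |` (fset_of ys `|` fset_of s))%fset.
pose F (ys : n.-tuple V) (x : V) (s : m.-tuple V) : \bar R :=
  ind (allv (T ys x s) (x :: ys)) * ((vertc (T ys x s) s) ^_ k)%:R%:E.
have F0 ys x s : 0 <= F ys x s by rewrite mule_ge0 ?ind_ge0.
have mF dX (X : measurableType dX) (ys : X -> n.-tuple V) (x : X -> V) (s : X -> m.-tuple V) :
    measurable_fun setT ys -> measurable_fun setT x -> measurable_fun setT s ->
    measurable_fun setT (fun w => F (ys w) (x w) (s w)).
  move=> mys mx ms.
  have mT : measurable_fun setT (fun w => T (ys w) (x w) (s w) : config).
    apply: measurable_fsetU1_comp => //.
    by apply: measurable_fsetU_comp; exact: measurable_fset_of_comp.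
  apply: emeasurable_funM; last exact: measurable_ffact_vertc_comp.
  apply: (measurable_ind_allv_comp mT (measurable_cons_comp mx mys)).
transitivity (\int[PT mu n]_ys
    (m.+1%:R%:E * \int[mu]_x \int[PT mu m]_s F ys x s)).
  apply: eq_integral => ys _.
  transitivity (\int[PT mu m.+1]_s \sum_(i < m.+1) F ys (tnth s i) (rem_tup i s)).
    apply: eq_integral => s _.
    pose U := (fset_of ys `|` fset_of s)%fset.
    have TU i : T ys (tnth s i) (rem_tup i s) = U.
      by rewrite /T /U (fset_of_rem i) fsetUCA.
    (* With [c] vertices in [s], [c ^_ k.+1] is [c * c.-1 ^_ k]; removing one vertex from the tuple
       leaves [c.-1] of them, while [U] does not depend on the removed index. *)
    transitivity (\sum_(i < m.+1) @ind R (vert U (tnth s i)) *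
      (@ind R (allv U ys) * ((vertc U s).-1 ^_ k)%:R%:E)); last first.
      apply: eq_bigr => i _; rewrite /F TU.
      have [vi|vi] := pselect (vert U (tnth s i)); last first.
        by rewrite indF // mul0e indF ?mul0e // => /(_ (tnth s i)); rewrite inE eqxx => /(_ isT).
      rewrite indT // mul1e; congr (_ * _).
        apply: eq_ind; split=> h y; last by move=> yys; apply: h; rewrite inE yys orbT.
        by rewrite inE => /orP[/eqP->//|]; exact: h.
      by rewrite (vertc_rem U i) (asboolT vi).
    rewrite -ge0_sume_distrl; last by move=> i _; exact: ind_ge0.
    rewrite (_ : \sum_(i < m.+1) @ind R (vert U (tnth s i)) = (vertc U s)%:R%:E).
      rewrite muleCA; congr (_ * _); by rewrite -EFinM -natrM.
    by rewrite sumEFin -natr_sum /vertc -sum1_count big_tuple [in RHS]big_mkcond.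
  rewrite ge0_integral_sum //; last first.
    by move=> i; apply: mF => //; first [exact: measurable_tnth|exact: measurable_rem_tup].
  rewrite (eq_bigr (fun=> \int[mu]_x \int[PT mu m]_s F ys x s)); last first.
    by move=> i _; rewrite integral_PT_extract //; apply: mF.
  by rewrite sumr_const card_ord mule_natl.
rewrite ge0_integralZl //; last 2 first.
- apply: (measurable_integral_param mu (f := fun ys x => \int[PT mu m]_s F ys x s)); last first.
    by move=> ys x; exact: integral_ge0.
  apply: (measurable_integral_param (PT mu m) (f := fun z s => F z.1 z.2 s)) => //.
  by apply: mF => //; exact: measurableT_comp.
- by move=> ys _; apply: integral_ge0 => x _; exact: integral_ge0.
congr (_ * _); rewrite integral_swap; last 2 first.
- apply: (measurable_integral_param (PT mu m) (f := fun z s => F z.1 z.2 s)) => //.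
  by apply: mF => //; exact: measurableT_comp.
- by move=> ys x; exact: integral_ge0.
rewrite /Lint integral_PTS; last 2 first.
- exact: measurable_Lint_integrand.
- by move=> ys; apply: integral_ge0 => s _; rewrite mule_ge0 ?ind_ge0.
apply: eq_integral => x _; apply: eq_integral => ys _.
apply: eq_integral => s _; rewrite /F /T.
by rewrite fset_of_cons fsetUA.
Qed.

End Recursions.

(** * Solution of the Pascal recursion *)

Section AlternatingExpansion.
Context {R : realType}.

(** Lowering [n] by one applies the difference of the commuting shifts in [j] and in [i]; the
    formula is the binomial theorem for the [n]-th power of this difference. *)
Lemma alternating_expansion (z : nat -> nat -> nat -> R) :
  (forall n i j, z n i j.+1 = z n.+1 i j + z n i.+1 j) ->
  forall n i j, z n i j =
    \sum_(r < n.+1) (-1) ^+ r * 'C(n, r)%:R * z 0 (i + r)%N (j + (n - r))%N.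
Proof.
move=> rec; elim=> [|n IH] i j.
  by rewrite big_ord1 /= expr0 bin0 !mul1r !addn0.
have -> : z n.+1 i j = z n i j.+1 - z n i.+1 j by rewrite rec addrK.
(* The extreme terms are split off; in between, the two sums, shifted by one index, merge by
   Pascal's rule. *)
rewrite !IH big_ord_recl [in RHS]big_ord_recl /= !bin0 -addrA; congr (_ + _).
  by rewrite !subn0 addSnnS.
rewrite [in RHS]big_ord_recr /=.
under [in RHS]eq_bigr => r _ do rewrite /bump /= add1n binS natrD.
rewrite [X in _ - X]big_ord_recr /= opprD addrA; congr (_ + _).
  rewrite -sumrB; apply: eq_bigr => r _; rewrite /bump /= !add1n subSS.
  rewrite (addSnnS i r) (_ : j.+1 + (n - r.+1) = j + (n - r))%N.
    by rewrite exprS; ring.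
  by rewrite addSnnS subnSK // ltn_ord.
rewrite /bump /= add1n !binn subnn subSS subnn addSnnS exprS; ring.
Qed.

End AlternatingExpansion.

(** * Mecke formula for the vertices *)

Section VertexMoments.
Context {R : realType} {d : nat}.
Local Notation V := (d.-tuple R).
Local Notation config := (@config R d).
Variable mu : probability V R.
Hypothesis mu_diffuse : forall x, mu [set x] = 0%E.
Local Open Scope ereal_scope.

Lemma Lint_ffact k n m :
  Lint mu n m k = (m ^_ k)%:R%:E * Lint mu (n + k) (m - k) 0.
Proof.
elim: k n m => [|k IH] n [|m].
- by rewrite ffactn0 mul1e addn0.
- by rewrite ffactn0 mul1e addn0.
- by rewrite Lint0 ffact0n mul0e.
- by rewrite LintS IH ffactSS natrM EFinM muleA addSnnS subSS.
Qed.

Lemma measurable_ffact_nvertices_comp dX (X : measurableType dX) (f : X -> config) k :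
  measurable_fun setT f ->
  measurable_fun setT (fun w => ((nvertices (f w)) ^_ k)%:R%:E : \bar R).
Proof.
move=> mf.
apply: (@measurable_nat_comp _ _ _ (fun w => nvertices (f w))
  (fun c => (c ^_ k)%:R%:E)).
exact: (measurableT_comp (@measurable_nvertices R d) mf).
Qed.

(** The two integrands may differ at tuples with repeated entries, which are negligible. *)
Lemma integral_nvertices_Lint m k :
  \int[PT mu m]_s ((nvertices (fset_tup s)) ^_ k)%:R%:E = Lint mu 0 m k.
Proof.
rewrite /Lint integral_PT0.
have fE (s : seq V) : (fset_of [tuple] `|` fset_of s)%fset = fset_of s.
  by apply/fsetP => y; rewrite !inE.
transitivity (\int[PT mu m]_s ((vertc (fset_tup s) s) ^_ k)%:R%:E); last first.
  by apply: eq_integral => s _; rewrite fE indT ?mul1e.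
apply: ge0_ae_eq_integral => //.
- by apply: measurable_ffact_nvertices_comp; exact: measurable_fset_tup.
- by apply: measurable_ffact_vertc_comp => //; exact: measurable_fset_tup.
have mN : measurable [set s : m.-tuple V | ~ uniq s].
  by apply: measurableC; exact: measurable_uniq_comp.
exists [set s : m.-tuple V | ~ uniq s]; split=> //.
- by rewrite -integral_ind // PT_not_uniq.
- move=> s /= h; apply: contrapT => /contrapT us; apply: h => _.
  by rewrite /fset_tup vertc_nvertices.
Qed.

(* Mean number of [k]-tuples of new points that are all vertices once added to
   the configuration [S]. *)
Definition new_vertices (S : {fset V}) k : \bar R :=
  \int[PT mu k]_ys ind (allv (S `|` fset_of ys)%fset ys).

Lemma new_vertices_ge0 S k : 0 <= new_vertices S k.
Proof. by apply: integral_ge0 => ys _; exact: ind_ge0. Qed.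

Lemma measurable_new_vertices k :
  measurable_fun setT (fun S : config => new_vertices S k).
Proof.
apply: (measurable_integral_param (PT mu k)
  (f := fun (S : config) (ys : k.-tuple V) => ind (allv (S `|` fset_of ys)%fset ys))).
  apply: measurable_ind_allv_comp => //; apply: measurable_fsetU_comp => //.
  exact: measurable_fset_of_comp.
by move=> *; exact: ind_ge0.
Qed.

Lemma Lint_new_vertices m k :
  Lint mu k m 0 = \int[PT mu m]_s new_vertices (fset_tup s) k.
Proof.
rewrite /Lint /new_vertices integral_swap.
- apply: eq_integral => s _; apply: eq_integral => ys _.
  by rewrite ffactn0 mule1 fsetUC.
- apply: emeasurable_funM.
    apply: measurable_ind_allv_comp => //.
    by apply: measurable_fsetU_comp; exact: measurable_fset_of_comp.
  apply: measurable_ffact_vertc_comp => //.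
  by apply: measurable_fsetU_comp; exact: measurable_fset_of_comp.
- by move=> ys s; rewrite mule_ge0 ?ind_ge0.
Qed.

Variables (t : R).
Hypothesis t_gt0 : (0 < t)%R.
Context {dO : measure_display} {Omega : measurableType dO}.
Variables (P : probability Omega R) (eta : Omega -> {fset V}).
Hypothesis eta_PPP : is_PPP P t mu eta.

(** Given [m] points, there are [m ^_ k] ordered choices of [k] of them, all equally likely to
    consist of vertices. The Poisson weights absorb this factor and leave the same process with [k]
    added points. *)
Lemma factorial_moment_nvertices k :
  \int[P]_w ((nvertices (eta w)) ^_ k)%:R%:E =
  (t ^+ k)%:E * \int[P]_w new_vertices (eta w) k.
Proof.
rewrite (expectation_eta t_gt0 eta_PPP
  (f := fun S : config => (nvertices S ^_ k)%:R%:E)) //; last first.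
  by apply: measurable_ffact_nvertices_comp.
rewrite (expectation_eta t_gt0 eta_PPP (f := fun S : config => new_vertices S k));
  [|exact: measurable_new_vertices|by move=> S; exact: new_vertices_ge0].
under eq_eseriesr => m _.
  rewrite integral_nvertices_Lint Lint_ffact add0n muleA -EFinM.
  over.
have w0 n : 0 <= (poisson_weight t n)%:E by rewrite lee_fin poisson_weight_ge0.
have L0 n m : 0 <= Lint mu n m 0.
  by apply: integral_ge0 => ys _; apply: integral_ge0 => s _; rewrite mule_ge0 ?ind_ge0.
rewrite -nneseriesZl; last first.
  move=> i _; rewrite mule_ge0 //.
  by apply: integral_ge0 => s _; exact: new_vertices_ge0.
(* Fewer than [k] points contribute nothing, and the remaining series is reindexed by [m - k]. *)
rewrite (nneseries_split 0 k) => [|m _]; last first.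
  by rewrite mule_ge0 // lee_fin mulr_ge0 // poisson_weight_ge0.
rewrite add0n big_mkord big1 ?add0e => [|m _]; last first.
  by rewrite ffact_small // mulr0 mul0e.
rewrite -nneseries_addn => [|m]; last first.
  by rewrite mule_ge0 // lee_fin mulr_ge0 // poisson_weight_ge0.
apply: eq_eseriesr => m _.
by rewrite poisson_weight_ffact ?leq_addl // addnK EFinM -muleA Lint_new_vertices.
Qed.

End VertexMoments.

(** * Growth of the hull when points are added *)

Section GapRecursion.
Context {R : realType} {d : nat}.
Local Notation V := (d.-tuple R).
Local Notation config := (@config R d).
Variable mu : probability V R.
Hypothesis mu_diffuse : forall x, mu [set x] = 0%E.
Local Open Scope ereal_scope.

Definition hgap (S T : {fset V}) : \bar R := mu (hull T `\` hull S).

Lemma measurable_hull (S : {fset V}) : measurable (hull S).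
Proof.
rewrite -(setCK (hull S)); apply: measurableC.
exact: (@measurable_nhull_comp _ _ _ _ (cst S) id).
Qed.

Lemma hgap_ge0 S T : 0 <= hgap S T.
Proof. exact: measure_ge0. Qed.

Lemma hgap_le1 S T : hgap S T <= 1.
Proof.
by apply: probability_le1; apply: measurableD; exact: measurable_hull.
Qed.

Lemma measurable_gap_comp dX (X : measurableType dX) (f g : X -> config) (x : X -> V) :
  measurable_fun setT f -> measurable_fun setT g -> measurable_fun setT x ->
  measurable [set w | hull (g w) (x w) /\ ~ hull (f w) (x w)].
Proof.
move=> mf mg mx.
apply: (@measurableI _ _ [set w | hull (g w) (x w)] [set w | ~ hull (f w) (x w)]).
  rewrite -(setCK [set w | hull (g w) (x w)]); apply: measurableC.
  exact: measurable_nhull_comp.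
exact: measurable_nhull_comp.
Qed.

Lemma hgapE S T : hgap S T = \int[mu]_x ind (hull T x /\ ~ hull S x).
Proof.
rewrite (@integral_ind _ _ _ mu (fun x => hull T x /\ ~ hull S x)) //.
exact: (@measurable_gap_comp _ _ (cst S) (cst T) id).
Qed.

Lemma measurable_hgap_comp dX (X : measurableType dX) (f g : X -> config) :
  measurable_fun setT f -> measurable_fun setT g ->
  measurable_fun setT (fun w => hgap (f w) (g w)).
Proof.
move=> mf mg.
rewrite (_ : (fun w => _) =
  (fun w => \int[mu]_x ind (hull (g w) x /\ ~ hull (f w) x))); last first.
  by apply/funext => w; rewrite hgapE.
apply: (measurable_integral_param mu
  (f := fun w x => ind (hull (g w) x /\ ~ hull (f w) x))).
  have mf1 : measurable_fun setT (fun z : X * V => f z.1) by exact: measurableT_comp.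
  have mg1 : measurable_fun setT (fun z : X * V => g z.1) by exact: measurableT_comp.
  by apply: measurable_ind; exact: (measurable_gap_comp mf1 mg1).
by move=> *; exact: ind_ge0.
Qed.

(** The power is the probability that [i] further independent points all fall into the gap between
    the two hulls. *)
Definition gapw i (S T : {fset V}) (ys : seq V) : \bar R :=
  ind (allv T ys) * hgap S T ^+ i.

Lemma gapw_ge0 i S T ys : 0 <= gapw i S T ys.
Proof. by rewrite mule_ge0 ?ind_ge0 // expe_ge0 // hgap_ge0. Qed.

Lemma gapw_le1 i S T ys : gapw i S T ys <= 1.
Proof.
have h : hgap S T ^+ i <= 1.
  elim: i => [|i IH]; first by rewrite expe0.
  rewrite expeS -[leRHS]mule1; apply: lee_pmul => //; rewrite ?hgap_ge0 ?hgap_le1 //.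
  by rewrite expe_ge0 // hgap_ge0.
rewrite /gapw -[leRHS]mule1; apply: lee_pmul => //; rewrite ?ind_ge0 ?ind_le1 //.
by rewrite expe_ge0 // hgap_ge0.
Qed.

Lemma measurable_gapw_comp i dX (X : measurableType dX) (f g : X -> config) n
  (s : X -> n.-tuple V) : measurable_fun setT f -> measurable_fun setT g ->
  measurable_fun setT s -> measurable_fun setT (fun w => gapw i (f w) (g w) (s w)).
Proof.
move=> mf mg ms; apply: emeasurable_funM; first exact: measurable_ind_allv_comp.
elim: i => [|i IH].
  by rewrite (_ : (fun w => _) = cst 1) //; apply/funext => w; rewrite expe0.
rewrite (_ : (fun w => _) =
  (fun w => hgap (f w) (g w) * hgap (f w) (g w) ^+ i)); last first.
  by apply/funext => w; rewrite expeS.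
apply: emeasurable_funM; [exact: measurable_hgap_comp|exact: IH].
Qed.

Definition outside (S : {fset V}) (bs : seq V) : Prop :=
  forall b, b \in bs -> ~ hull S b.

Lemma measurable_outside_comp dX (X : measurableType dX) (f : X -> config) n
  (s : X -> n.-tuple V) : measurable_fun setT f -> measurable_fun setT s ->
  measurable_fun setT (fun w => ind (outside (f w) (s w)) : \bar R).
Proof.
move=> mf ms; apply: measurable_ind.
apply: (@measurable_allin _ _ _ X n s (fun w y => ~ hull (f w) y)) => i.
by apply: measurable_nhull_comp => //; exact: measurable_tnth_comp.
Qed.

(* [gapw i], integrated over [n] points required to be vertices and, in [Zint],
   over [j] points merely required to lie outside [hull S]. The case [n = 0] is
   the integral of the theorem with [r = i] and [k - r = j]; the case
   [i = j = 0] counts [n]-tuples of vertices. *)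
Definition gapint n i (S : {fset V}) (bs : seq V) : \bar R :=
  \int[PT mu n]_ys gapw i S ((S `|` fset_of bs) `|` fset_of ys)%fset ys.

Definition Zint n i j (S : {fset V}) : \bar R :=
  \int[PT mu j]_bs (ind (outside S bs) * gapint n i S bs).

Lemma gapint_ge0 n i S bs : 0 <= gapint n i S bs.
Proof. by apply: integral_ge0 => ys _; exact: gapw_ge0. Qed.

Lemma measurable_gapint_comp n i dX (X : measurableType dX) (f : X -> config) j
  (s : X -> j.-tuple V) : measurable_fun setT f -> measurable_fun setT s ->
  measurable_fun setT (fun w => gapint n i (f w) (s w)).
Proof.
move=> mf ms.
apply: (measurable_integral_param (PT mu n) (f := fun w (ys : n.-tuple V) =>
  gapw i (f w) ((f w `|` fset_of (s w)) `|` fset_of ys)%fset ys)); last first.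
  by move=> *; exact: gapw_ge0.
have mf1 : measurable_fun setT (fun z : X * n.-tuple V => f z.1).
  exact: measurableT_comp.
apply: measurable_gapw_comp => //.
apply: measurable_fsetU_comp; last exact: measurable_fset_of_comp.
apply: measurable_fsetU_comp => //.
apply: (@measurable_fset_of_comp _ _ _ _ j (fun z => s z.1)).
exact: measurableT_comp.
Qed.

Lemma integral_le1 dX (X : measurableType dX) (m : probability X R) (f : X -> \bar R) :
  measurable_fun setT f -> (forall x, 0 <= f x) -> (forall x, f x <= 1) ->
  \int[m]_x f x <= 1.
Proof.
move=> mf f0 f1; rewrite -[leRHS](integral_prob_cst m 1).
by apply: ge0_le_integral.
Qed.

Lemma gapint_le1 n i S j (bs : j.-tuple V) : gapint n i S bs <= 1.
Proof.
apply: integral_le1 => [|ys|ys]; [|exact: gapw_ge0|exact: gapw_le1].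
apply: (@measurable_gapw_comp _ _ _ (cst S)) => //.
by apply: measurable_fsetU_comp => //; exact: measurable_fset_of_comp.
Qed.

Lemma Zint_ge0 n i j S : 0 <= Zint n i j S.
Proof.
by apply: integral_ge0 => bs _; rewrite mule_ge0 ?ind_ge0 ?gapint_ge0.
Qed.

Lemma measurable_Zint n i j : measurable_fun setT (fun S : config => Zint n i j S).
Proof.
apply: (measurable_integral_param (PT mu j) (f := fun (S : config) (bs : j.-tuple V) =>
  ind (outside S bs) * gapint n i S bs)); last first.
  by move=> S bs; rewrite mule_ge0 ?ind_ge0 ?gapint_ge0.
apply: emeasurable_funM; first exact: measurable_outside_comp.
exact: measurable_gapint_comp.
Qed.

(** This bound makes the expectations finite, so that the recursion can be solved by subtraction. *)
Lemma Zint_le1 n i j S : Zint n i j S <= 1.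
Proof.
apply: integral_le1 => [|bs|bs].
- apply: emeasurable_funM; first exact: (@measurable_outside_comp _ _ (cst S)).
  exact: (@measurable_gapint_comp _ _ _ _ (cst S)).
- by rewrite mule_ge0 ?ind_ge0 ?gapint_ge0.
- rewrite -[leRHS]mule1; apply: lee_pmul; rewrite ?ind_ge0 ?ind_le1 ?gapint_ge0 //.
  exact: gapint_le1.
Qed.

(* A point [b] added to [U] outside [hull S] either becomes a vertex or lies in
   [hull U], in which case it changes neither the hull nor its vertices. *)
Lemma gapw_fsetU1 i (S U : {fset V}) ys b :
  (S `<=` U)%fset -> {subset ys <= U} -> b \notin U ->
  ind (~ hull S b) * gapw i S (b |` U)%fset ys =
  ind (vert (b |` U)%fset b) * gapw i S (b |` U)%fset ys +
  ind (hull U b /\ ~ hull S b) * gapw i S U ys.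
Proof.
move=> SU ysU bU.
have vb : vert (b |` U)%fset b <-> ~ hull U b.
  by rewrite -extreme_vert ?fset1U1 // extreme_hullD1 ?fset1U1 // fsetU1K.
have [Ub|Ub] := pselect (hull U b); last first.
  rewrite (indT (vb.2 Ub)) (@indF _ (hull U b /\ _)); last by case.
  by rewrite mul0e adde0 indT // => Sb; apply: Ub; exact: (hullS SU).
rewrite (@indF _ (vert _ _)); last by move=> /vb.
rewrite mul0e add0e; congr (_ * _); first by apply: eq_ind; split=> // -[].
have hE := hullU1 Ub; rewrite /gapw /hgap hE; congr (_ * _).
apply: eq_ind; split=> h y yys; have yU := ysU _ yys; have := h _ yys.
  by rewrite -!extreme_vert ?hE // fset1Ur.
by rewrite -!extreme_vert ?hE // fset1Ur.
Qed.

(** One outside point [b] is singled out and [gapw_fsetU1] is integrated over it. If [b] becomes a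
    vertex, it joins [ys]; otherwise it lies in the gap, and its integral supplies one more factor
    [hgap]. *)
Lemma Zint_rec n i j S : Zint n i j.+1 S = Zint n.+1 i j S + Zint n i.+1 j S.
Proof.
pose U (bs ys : seq V) := ((S `|` fset_of bs) `|` fset_of ys)%fset.
have mU dX (X : measurableType dX) a b (bs : X -> a.-tuple V) (ys : X -> b.-tuple V) :
    measurable_fun setT bs -> measurable_fun setT ys ->
    measurable_fun setT (fun w => U (bs w) (ys w) : config).
  move=> mbs mys; apply: measurable_fsetU_comp; last exact: measurable_fset_of_comp.
  apply: (@measurable_fsetU_comp _ _ _ _ (cst S)) => //.
  exact: measurable_fset_of_comp.
have SU bs ys : (S `<=` U bs ys)%fset.
  by apply/fsubsetP => y yS; rewrite !inE yS.
have ysU bs ys : {subset ys <= U bs ys}.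
  by move=> y yys; rewrite !inE yys orbT.
(* [E1], [E2] and [E3] are the three terms of [gapw_fsetU1]. *)
pose E1 (bs ys : seq V) b := ind (~ hull S b) * gapw i S (b |` U bs ys)%fset ys.
pose E2 (bs ys : seq V) b :=
  ind (vert (b |` U bs ys)%fset b) * gapw i S (b |` U bs ys)%fset ys.
pose E3 (bs ys : seq V) b := ind (hull (U bs ys) b /\ ~ hull S b) * gapw i S (U bs ys) ys.
have E10 bs ys b : 0 <= E1 bs ys b by rewrite mule_ge0 ?ind_ge0 ?gapw_ge0.
have E20 bs ys b : 0 <= E2 bs ys b by rewrite mule_ge0 ?ind_ge0 ?gapw_ge0.
have E30 bs ys b : 0 <= E3 bs ys b by rewrite mule_ge0 ?ind_ge0 ?gapw_ge0.
have mE dX (X : measurableType dX) a c (bs : X -> a.-tuple V) (ys : X -> c.-tuple V)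
    (b : X -> V) : measurable_fun setT bs -> measurable_fun setT ys ->
    measurable_fun setT b ->
    [/\ measurable_fun setT (fun w => E1 (bs w) (ys w) (b w)),
        measurable_fun setT (fun w => E2 (bs w) (ys w) (b w)) &
        measurable_fun setT (fun w => E3 (bs w) (ys w) (b w))].
  move=> mbs mys mb.
  have mUw := mU _ _ _ _ _ _ mbs mys.
  have mbU := measurable_fsetU1_comp mUw mb.
  have mS : measurable_fun setT (cst S : X -> config) by exact: measurable_cst.
  split; apply: emeasurable_funM.
  - by apply: measurable_ind; exact: (measurable_nhull_comp mS mb).
  - exact: (measurable_gapw_comp i mS mbU mys).
  - exact: measurable_ind_vert_comp.
  - exact: (measurable_gapw_comp i mS mbU mys).
  - by apply: measurable_ind; exact: (measurable_gap_comp mS mUw mb).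
  - exact: (measurable_gapw_comp i mS mUw mys).
have mO m : measurable_fun setT (fun bs : m.-tuple V => ind (outside S bs) : \bar R).
  exact: (@measurable_outside_comp _ _ (cst S)).
have UE b (bs ys : seq V) : ((S `|` fset_of (b :: bs)) `|` fset_of ys)%fset =
    (b |` U bs ys)%fset.
  by rewrite /U fset_of_cons (fsetUCA S) -fsetUA.
have UE' b (bs ys : seq V) : ((S `|` fset_of bs) `|` fset_of (b :: ys))%fset =
    (b |` U bs ys)%fset.
  by rewrite /U fset_of_cons fsetUCA.
have mc dX (X : measurableType dX) dY (Y : measurableType dY) (y : Y) :
    measurable_fun setT (cst y : X -> Y) by exact: measurable_cst.
have mint1 (bs : j.-tuple V) :
    [/\ measurable_fun setT (fun b => \int[PT mu n]_ys E1 bs ys b),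
        measurable_fun setT (fun b => \int[PT mu n]_ys E2 bs ys b) &
        measurable_fun setT (fun ys : n.-tuple V => \int[mu]_b E2 bs ys b)].
  have [m1 m2 _] := mE _ (V * n.-tuple V)%type j n (cst bs) snd fst
    (mc _ _ _ _ _) measurable_snd measurable_fst.
  have [_ m2' _] := mE _ (n.-tuple V * V)%type j n (cst bs) fst snd
    (mc _ _ _ _ _) measurable_fst measurable_snd.
  split.
  - exact: (measurable_integral_param (PT mu n) (f := fun b ys => E1 bs ys b)).
  - exact: (measurable_integral_param (PT mu n) (f := fun b ys => E2 bs ys b)).
  - exact: (measurable_integral_param mu (f := fun (ys : n.-tuple V) b => E2 bs ys b) m2').
(* The point [b] is the head of the [j.+1] outside points; its integral is moved inside that over
   the others. *)
transitivity (\int[PT mu j]_bs (ind (outside S bs) *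
    \int[mu]_b \int[PT mu n]_ys E1 bs ys b)).
  rewrite /Zint integral_PTS; last 2 first.
  - apply: emeasurable_funM; first exact: mO.
    exact: (@measurable_gapint_comp _ _ _ _ (cst S)).
  - by move=> bs; rewrite mule_ge0 ?ind_ge0 ?gapint_ge0.
  transitivity (\int[mu]_b \int[PT mu j]_bs (ind (outside S bs) *
      \int[PT mu n]_ys E1 bs ys b)).
    apply: eq_integral => b _; apply: eq_integral => bs _.
    have -> : \int[PT mu n]_ys E1 bs ys b = ind (~ hull S b) *
        gapint n i S (b :: bs).
      transitivity (\int[PT mu n]_ys (ind (~ hull S b) *
          gapw i S ((S `|` fset_of (b :: bs)) `|` fset_of ys)%fset ys)).
        by apply: eq_integral => ys _; rewrite /E1 UE.
      apply: ge0_integralZl => //.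
      - apply: (@measurable_gapw_comp _ _ _ (cst S)) => //.
        apply: measurable_fsetU_comp; last exact: measurable_fset_of_comp.
        exact: measurable_cst.
      - by move=> ys _; exact: gapw_ge0.
      - exact: ind_ge0.
    rewrite muleA indM; congr (_ * _); apply: eq_ind; split=> [h|[h1 h2] y].
      by split=> [y ys|]; apply: h; rewrite inE ?eqxx ?ys ?orbT.
    by rewrite inE => /orP[/eqP->//|]; exact: h1.
  rewrite integral_swap; last 2 first.
  - apply: emeasurable_funM; first exact: (measurableT_comp (mO j) measurable_snd).
    apply: (measurable_integral_param (PT mu n)
      (f := fun (z : V * j.-tuple V) (ys : n.-tuple V) => E1 z.2 ys z.1)) => //.
    have mz1 : measurable_fun setT (fun z : (V * j.-tuple V) * n.-tuple V => z.1.1).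
      exact: measurableT_comp.
    have mz2 : measurable_fun setT (fun z : (V * j.-tuple V) * n.-tuple V => z.1.2).
      exact: measurableT_comp.
    by have [] := mE _ _ _ _ _ _ _ mz2 measurable_snd mz1.
  - by move=> b bs; rewrite mule_ge0 ?ind_ge0 // integral_ge0.
  apply: eq_integral => bs _; rewrite ge0_integralZl //.
  - by case: (mint1 bs).
  - by move=> b _; exact: integral_ge0.
  - exact: ind_ge0.
have gE (bs : j.-tuple V) : \int[mu]_b \int[PT mu n]_ys E1 bs ys b =
    gapint n.+1 i S bs + gapint n i.+1 S bs.
  have [m1 m2 m3] := mint1 bs.
  rewrite integral_swap //; last first.
    by have [] := mE _ (V * n.-tuple V)%type j n (cst bs) snd fst
      (mc _ _ _ _ _) measurable_snd measurable_fst.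
  transitivity (\int[PT mu n]_ys (\int[mu]_b E2 bs ys b +
      gapw i.+1 S (U bs ys) ys)).
    apply: eq_integral => ys _.
    have [e1 e2 e3] := mE _ V j n (cst bs) (cst ys) id
      (mc _ _ _ _ _) (mc _ _ _ _ _) (@measurable_id _ _ _).
    transitivity (\int[mu]_b (E2 bs ys b + E3 bs ys b)).
      (* The pointwise identity requires [b] to be a new point, hence holds off the finite set
         [U bs ys]. *)
      apply: (@eq_integral_off_seq _ _ mu mu_diffuse (U bs ys)) => //.
      + exact: emeasurable_funD.
      + by move=> b; rewrite adde_ge0.
      + by move=> b bU; apply: gapw_fsetU1.
    rewrite ge0_integralD //; congr (_ + _).
    rewrite ge0_integralZr //; last 3 first.
    + apply: measurable_ind.
      exact: (@measurable_gap_comp _ _ (cst S) (cst (U bs ys)) id).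
    + by move=> b _; exact: ind_ge0.
    + exact: gapw_ge0.
    by rewrite -hgapE /gapw expeS muleCA.
  rewrite ge0_integralD //; last 3 first.
  - by move=> ys _; exact: integral_ge0.
  - by move=> ys _; exact: gapw_ge0.
  - apply: (@measurable_gapw_comp _ _ _ (cst S)) => //; exact: mU.
  congr (_ + _); rewrite -integral_swap //; last first.
    by have [] := mE _ (V * n.-tuple V)%type j n (cst bs) snd fst
      (mc _ _ _ _ _) measurable_snd measurable_fst.
  rewrite /gapint integral_PTS; last 2 first.
  - apply: (@measurable_gapw_comp _ _ _ (cst S)) => //; exact: mU.
  - by move=> ys; exact: gapw_ge0.
  apply: eq_integral => b _; apply: eq_integral => ys _.
  rewrite UE' /E2 /gapw muleA indM; congr (_ * _); apply: eq_ind.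
  split=> [[h1 h2] y|h].
    by rewrite inE => /orP[/eqP->//|]; exact: h2.
  by split=> [|y yys]; apply: h; rewrite inE ?eqxx ?yys ?orbT.
under eq_integral => bs _ do rewrite gE ge0_muleDr ?gapint_ge0 //.
have mg m l : measurable_fun setT (fun bs : j.-tuple V =>
    ind (outside S bs) * gapint m l S bs).
  apply: emeasurable_funM; first exact: mO.
  exact: (@measurable_gapint_comp _ _ _ _ (cst S)).
by rewrite ge0_integralD // => bs _; rewrite mule_ge0 ?ind_ge0 ?gapint_ge0.
Qed.

Lemma Zint_new_vertices k S : Zint k 0 0 S = new_vertices mu S k.
Proof.
rewrite /Zint integral_PT0 indT ?mul1e //.
apply: eq_integral => ys _; rewrite /gapw expe0 mule1.
suff -> : ((S `|` fset_of [::]) `|` fset_of ys)%fset = (S `|` fset_of ys)%fset by [].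
by apply/fsetP => y; rewrite !inE /= orbF.
Qed.

Lemma Zint_iter_int i j S : Zint 0 i j S =
  iter_int mu (~` hull S) j
    (fun xs => (mu (hull (S `|` fset_of xs)%fset `\` hull S)) ^+ i).
Proof.
have fE xs : gapint 0 i S xs = hgap S (S `|` fset_of xs)%fset ^+ i.
  rewrite /gapint integral_PT0 /gapw indT ?mul1e //.
  suff -> : ((S `|` fset_of xs) `|` fset_of [::])%fset = (S `|` fset_of xs)%fset by [].
  by apply/fsetP => y; rewrite !inE orbF.
rewrite iter_int_PT //.
- by apply: eq_integral => bs _; rewrite fE.
- by apply: measurableC; exact: measurable_hull.
- by move=> s; rewrite expe_ge0 // hgap_ge0.
- have := @measurable_gapint_comp 0 i _ _ (cst S) j id.
  move=> /(_ (@measurable_cst _ _ _ _ _ _) (@measurable_id _ _ _)).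
  by under eq_fun do rewrite fE.
Qed.

Lemma Zint_outside k S : Zint 0 0 k S = mu (~` hull S) ^+ k.
Proof.
rewrite /Zint -PT_all; last by apply: measurableC; exact: measurable_hull.
rewrite -integral_ind; last by apply: measurable_all; apply: measurableC; exact: measurable_hull.
apply: eq_integral => bs _; rewrite /gapint integral_PT0 /gapw expe0 mule1.
by rewrite [X in _ * X]indT ?mule1.
Qed.

(** Without added points the gap is empty. This removes the term [r = k] of the expansion. *)
Lemma Zint_no_point k S : Zint 0 k.+1 0 S = 0.
Proof.
rewrite /Zint integral_PT0 /gapint integral_PT0 /gapw expeS /hgap.
suff -> : ((S `|` fset_of [::]) `|` fset_of [::])%fset = S.
  by rewrite setDv measure0 mul0e !mule0.
by apply/fsetP => y; rewrite !inE /= !orbF.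
Qed.

End GapRecursion.

(** * Expectation over the process and the final identity *)

Section Expectation.
Context {R : realType} {d : nat}.
Local Notation V := (d.-tuple R).
Variables (mu : probability V R) (t : R).
Hypothesis t_gt0 : 0 < t.
Context {dO : measure_display} {Omega : measurableType dO}.
Variables (P : probability Omega R) (eta : Omega -> {fset V}).
Hypothesis eta_PPP : is_PPP P t mu eta.
Local Open Scope ereal_scope.

Let mu_diffuse := intensity_diffuse t_gt0 eta_PPP.

Definition EZint n i j : \bar R := \int[P]_w Zint mu n i j (eta w).

Lemma measurable_Zint_eta n i j : measurable_fun setT (fun w => Zint mu n i j (eta w)).
Proof.
exact: (measurableT_comp (measurable_Zint mu n i j) (measurable_eta eta_PPP)).
Qed.

Lemma EZint_fineK n i j : (fine (EZint n i j))%:E = EZint n i j.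
Proof.
apply: fineK; rewrite ge0_fin_numE.
  apply: (@le_lt_trans _ _ 1); last exact: ltry.
  by apply: integral_le1; [exact: measurable_Zint_eta|move=> w; exact: Zint_ge0|
     move=> w; exact: Zint_le1].
by apply: integral_ge0 => w _; exact: Zint_ge0.
Qed.

Lemma EZint_rec n i j :
  (fine (EZint n i j.+1) = fine (EZint n.+1 i j) + fine (EZint n i.+1 j))%R.
Proof.
apply: EFin_inj; rewrite EFinD; apply: (etrans (EZint_fineK n i j.+1)).
apply: (etrans _ (esym (f_equal2 _ (EZint_fineK n.+1 i j) (EZint_fineK n i.+1 j)))).
rewrite /EZint.
rewrite -ge0_integralD //.
- by apply: eq_integral => w _; rewrite Zint_rec.
- by move=> w _; exact: Zint_ge0.
- exact: measurable_Zint_eta.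
- by move=> w _; exact: Zint_ge0.
- exact: measurable_Zint_eta.
Qed.

Lemma factorial_moment_expansion k :
  \int[P]_w ((nvertices (eta w)) ^_ k)%:R%:E =
  (t ^+ k * \sum_(r < k.+1) (-1) ^+ r * 'C(k, r)%:R *
     fine (EZint 0 r (k - r)))%:E.
Proof.
rewrite (factorial_moment_nvertices mu_diffuse t_gt0 eta_PPP) EFinM; congr (_ * _).
transitivity (EZint k 0 0).
  by apply: eq_integral => w _; rewrite Zint_new_vertices.
rewrite -EZint_fineK; congr EFin.
have := alternating_expansion (z := fun n i j => fine (EZint n i j)) EZint_rec.
move=> /(_ k 0%N 0%N) /= ->.
by apply: eq_bigr => r _; rewrite !add0n.
Qed.

End Expectation.

Unset Implicit Arguments. Set Strict Implicit. Set Printing Implicit Defensive.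

Theorem theorem5 (R : realType) (d : nat)
  (mu : probability (d.-tuple R) R)
  (mu_ac : abs_cont_lebesgue mu)
  (t : R) (t_gt0 : 0 < t)
  (dO : measure_display) (Omega : measurableType dO) (P : probability Omega R)
  (eta : Omega -> {fset d.-tuple R})
  (eta_PPP : is_PPP P t mu eta)
  (k : nat) :
  (\int[P]_w ((nvertices (eta w)) ^_ k)%:R%:E
   = (t ^+ k)%:E * \int[P]_w (mu (~` hull (eta w))) ^+ k
     - (t ^+ k)%:E *
       \sum_(1 <= r < k)
         ((-1) ^+ r.+1 * 'C(k, r)%:R)%:E *
         \int[P]_w iter_int mu (~` hull (eta w)) (k - r)
            (fun xs => (mu (hull (eta w `|` [fset x | x in xs])%fset
                            `\` hull (eta w))) ^+ r))%E.
Proof.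
pose z r := fine (EZint mu P eta 0 r (k - r)).
have zE r : (z r)%:E = EZint mu P eta 0 r (k - r) by exact: EZint_fineK eta_PPP _ _ _.
have -> : (\int[P]_w (mu (~` hull (eta w))) ^+ k)%E = (z 0)%:E.
  by rewrite zE subn0; apply: eq_integral => w _; rewrite Zint_outside.
have -> : (\sum_(1 <= r < k)
         ((-1) ^+ r.+1 * 'C(k, r)%:R)%:E *
         \int[P]_w iter_int mu (~` hull (eta w)) (k - r)
            (fun xs => (mu (hull (eta w `|` [fset x | x in xs])%fset
                            `\` hull (eta w))) ^+ r))%E =
    (\sum_(1 <= r < k) ((-1) ^+ r.+1 * 'C(k, r)%:R * z r))%:E.
  rewrite -sumEFin; apply: eq_bigr => r _; rewrite [RHS]EFinM zE; congr (_ * _)%E.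
  by apply: eq_integral => w _; rewrite Zint_iter_int.
rewrite (factorial_moment_expansion t_gt0 eta_PPP) -!EFinM -EFinB; congr EFin.
rewrite -mulrBr; congr (_ * _).
rewrite (eq_bigr (fun r : 'I_k.+1 => (-1) ^+ r * 'C(k, r)%:R * z r)) //.
(* For [k = 0] the terms [r = 0] and [r = k] coincide, and this common term survives; otherwise the
   last term vanishes by [Zint_no_point]. *)
case: k @z zE => [|k] z zE.
  by rewrite big_ord1 big_geq // subr0 /= expr0 bin0 !mul1r.
have zk : z k.+1 = 0.
  apply: EFin_inj; rewrite zE subnn /EZint.
  transitivity (0 : \bar R)%E; last by [].
  by apply: integral0_eq => w _; exact: Zint_no_point.
rewrite (big_ord_recr k.+1) /= zk mulr0 addr0.
rewrite big_ord_recl expr0 bin0 !mul1r; congr (_ + _).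
rewrite big_add1 big_mkord -sumrN; apply: eq_bigr => r _.
by rewrite /= !exprS; ring.
Qed.
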